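(* ML-CAP-STEINER-TREE is solvable in polynomial time in DAGs if the number $K$ of terminals is fixed.
   Context: A DAG is a finite directed graph without directed circuits. ML-CAP-STEINER-TREE (directed version). Input: a connected directed graph $G=(V,E)$; a set $T\subset V$ of $K\ge 2$ terminals; a root $r\in V\setminus T$ such that there is a directed path from $r$ to every vertex of $V$; a nonnegative rational length $\ell(e)$ and a positive integer capacity $c(e)$ for every arc $e\in E$. Objective: determine, if one exists, a tree $S$ in $G$, directed away from its root $r$, that spans all vertices of $T$ (it need not span $V$), satisfies the capacity constraints, and has minimum total length. The capacity constraints say: for every arc $e=(u,v)$ of $S$, the subtree of $S$ rooted at $v$ contains at most $c(e)$ terminals. *)

(* Defs.v *)
From mathcomp Require Import all_boot all_order all_algebra.

Set Implicit Arguments.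
Unset Strict Implicit.
Unset Printing Implicit Defensive.

Import Order.TTheory GRing.Theory Num.Theory.

(** * Polynomial time: random access machine with logarithmic cost

    Structured programs over a memory of natural numbers indexed by natural
    numbers, with a read-only input sequence and an append-only output
    sequence.  Every operation is charged the number of binary digits of all
    the numbers it handles (operands, addresses and result), so multiplication
    and division may be primitive: the model is polynomially equivalent to
    Turing machines. *)

(* [trunc_log 2 0 = 0], so 0 has one digit. *)
Definition bitlen (n : nat) : nat := (trunc_log 2 n).+1.

Definition bitsize (w : seq nat) : nat := \sum_(x <- w) bitlen x.

(* [Fetch a] is the content of the memory cell whose address is the value of [a],
   [Input a] the input item at that position (0 beyond the end of the input).
   [Sub] is truncated, and [Div _ 0] evaluates to 0. *)
Inductive expr : Type :=
  | Const of nat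
  | InputLength
  | Input of expr
  | Fetch of expr
  | Add of expr & expr
  | Sub of expr & expr
  | Mul of expr & expr
  | Div of expr & expr.

Inductive cmd : Type :=
  | Skip
  | Store of expr & expr
  | Write of expr
  | Seq of cmd & cmd
  | If of expr & cmd & cmd
  | While of expr & cmd.

Definition memory := nat -> nat.

Definition upd (m : memory) (a v : nat) : memory :=
  fun b => if b == a then v else m b.

Fixpoint eval (w : seq nat) (m : memory) (e : expr) : nat :=
  match e with
  | Const n => n
  | InputLength => size w
  | Input a => nth 0 w (eval w m a)
  | Fetch a => m (eval w m a)
  | Add a b => eval w m a + eval w m b
  | Sub a b => eval w m a - eval w m b
  | Mul a b => eval w m a * eval w m b
  | Div a b => eval w m a %/ eval w m b
  end.

Fixpoint ecost (w : seq nat) (m : memory) (e : expr) : nat :=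
  bitlen (eval w m e) +
  match e with
  | Const _ | InputLength => 0
  | Input a | Fetch a => ecost w m a
  | Add a b | Sub a b | Mul a b | Div a b => ecost w m a + ecost w m b
  end.

Definition state : Type := memory * seq nat.

(* [exec w c s t s'] : on input [w], from memory and output [s], the program [c]
   halts with memory and output [s'] at total cost [t].  A condition holds iff
   its value is nonzero. *)
Inductive exec (w : seq nat) : cmd -> state -> nat -> state -> Prop :=
  | exec_skip s : exec w Skip s 1 s
  | exec_store a e m o :
      exec w (Store a e) (m, o) (ecost w m a + ecost w m e)
        (upd m (eval w m a) (eval w m e), o)
  | exec_write e m o :
      exec w (Write e) (m, o) (ecost w m e) (m, rcons o (eval w m e))
  | exec_seq c1 c2 s1 s2 s3 t1 t2 :
      exec w c1 s1 t1 s2 -> exec w c2 s2 t2 s3 ->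
      exec w (Seq c1 c2) s1 (t1 + t2) s3
  | exec_if e c1 c2 s t s' :
      exec w (if eval w s.1 e != 0 then c1 else c2) s t s' ->
      exec w (If e c1 c2) s (ecost w s.1 e + t) s'
  | exec_while_false e c s :
      eval w s.1 e = 0 -> exec w (While e c) s (ecost w s.1 e) s
  | exec_while_true e c s1 s2 s3 t1 t2 :
      eval w s1.1 e <> 0 ->
      exec w c s1 t1 s2 -> exec w (While e c) s2 t2 s3 ->
      exec w (While e c) s1 (ecost w s1.1 e + t1 + t2) s3.

Lemma exec_det w c s t1 s1 t2 s2 :
  exec w c s t1 s1 -> exec w c s t2 s2 -> t1 = t2 /\ s1 = s2.
Proof.
move=> H; elim: H t2 s2 => {c s t1 s1}
  [s|a e m o|e m o|c1 c2 sa sb sc ta tb _ IH1 _ IH2|e c1 c2 s t s' _ IH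
  |e c s e0|e c sa sb sc ta tb en0 _ IH1 _ IH2] t2 s2 H; inversion H; subst=> //.
- match goal with [ A : exec w c1 _ _ _ |- _ ] => case: (IH1 _ _ A) end.
  move=> ? ?; subst.
  by match goal with [ A : exec w c2 _ _ _ |- _ ] => case: (IH2 _ _ A) end => -> ->.
- by match goal with [ A : exec w _ s _ s2 |- _ ] => case: (IH _ _ A) end => -> ->.
- match goal with [ A : exec w c _ _ _ |- _ ] => case: (IH1 _ _ A) end.
  move=> ? ?; subst.
  by match goal with [ A : exec w (While e c) _ _ _ |- _ ] =>
    case: (IH2 _ _ A) end => -> ->.
Qed.

Definition runs (c : cmd) (w : seq nat) (t : nat) (out : seq nat) : Prop :=
  exists m, exec w c (fun=> 0, [::]) t (m, out).

(* [enc x w] : the word [w] is an encoding of [x];  [sol x out] : [out] is a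
   correct answer on [x].  Only the [x] satisfying [dom] are legal inputs. *)
Definition solvable_in_polynomial_time (X : Type) (dom : X -> Prop)
    (enc sol : X -> seq nat -> Prop) : Prop :=
  exists (c : cmd) (p : {poly nat}), forall (x : X) (w : seq nat),
    dom x -> enc x w ->
    exists (t : nat) (out : seq nat),
      [/\ runs c w t out, t <= p.[bitsize w]%R & sol x out].

(** * Directed graphs: vertex type [V], arc set [E : {set V * V}] *)

Section Digraph.

Variable V : finType.
Implicit Types (E F : {set V * V}) (W : {set V}).

Definition arc_rel E : rel V := fun u v => (u, v) \in E.

Definition weakly_connected E : Prop :=
  forall u v, connect (fun x y => arc_rel E x y || arc_rel E y x) u v.

Definition acyclic E : Prop :=
  forall c : seq V, cycle (arc_rel E) c -> uniq c -> c = [::].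

(* The subgraph (W, F) is a tree directed away from r.  As [p] ranges over
   walks, which may repeat vertices, circuits are excluded as well. *)
Definition out_tree (r : V) W F : Prop :=
  [/\ r \in W,
      (forall u v, (u, v) \in F -> u \in W /\ v \in W)
    & (forall v, v \in W ->
         exists! p : seq V, path (arc_rel F) r p /\ last r p = v)].

Definition subtree F (v : V) : {set V} := [set x | connect (arc_rel F) v x].

End Digraph.

(** * Minimum-length capacitated Steiner trees *)

Record instance := Instance {
  nvert : nat;
  arcs : {set 'I_nvert * 'I_nvert};
  terminals : {set 'I_nvert};
  rootv : 'I_nvert;
  len : 'I_nvert * 'I_nvert -> rat;
  cap : 'I_nvert * 'I_nvert -> nat
}.

Definition valid (I : instance) : Prop :=
  [/\ weakly_connected (arcs I),
      2 <= #|terminals I|,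
      rootv I \notin terminals I,
      (forall v, connect (arc_rel (arcs I)) (rootv I) v)
    & (forall e, e \in arcs I -> (0 <= len e)%R /\ 0 < cap e)].

Definition feasible (I : instance)
    (W : {set 'I_(nvert I)}) (F : {set 'I_(nvert I) * 'I_(nvert I)}) : Prop :=
  [/\ F \subset arcs I,
      out_tree (rootv I) W F,
      terminals I \subset W
    & (forall e, e \in F -> #|terminals I :&: subtree F e.2| <= cap e)].
Arguments feasible : clear implicits.

Definition total_length (I : instance)
    (F : {set 'I_(nvert I) * 'I_(nvert I)}) : rat :=
  (\sum_(e in F) len e)%R.
Arguments total_length : clear implicits.

Definition optimal (I : instance)
    (W : {set 'I_(nvert I)}) (F : {set 'I_(nvert I) * 'I_(nvert I)}) : Prop :=
  feasible I W F /\
  forall W' F', feasible I W' F' -> (total_length I F <= total_length I F')%R.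
Arguments optimal : clear implicits.

(* Numbers are later measured in binary; a length is written as its reduced
   fraction (the numerator is nonnegative on valid instances). *)
Definition arc_code (I : instance) (e : 'I_(nvert I) * 'I_(nvert I)) : seq nat :=
  [:: val e.1; val e.2; `|numq (len e)|%N; `|denq (len e)|%N; cap e].

(* Terminals and arcs may be listed in any order. *)
Definition encodes (I : instance) (w : seq nat) : Prop :=
  exists (ts : seq 'I_(nvert I)) (es : seq ('I_(nvert I) * 'I_(nvert I))),
    [/\ perm_eq ts (enum (terminals I)),
        perm_eq es (enum (arcs I))
      & w = [:: nvert I; size ts; size es; val (rootv I)]
              ++ [seq val t | t <- ts]
              ++ flatten [seq arc_code e | e <- es]].

(* The answer is [:: 0] if there is no feasible tree, and otherwise 1 followed
   by the arcs of an optimal tree, in any order and without repetition. *)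
Definition solves (I : instance) (out : seq nat) : Prop :=
  (exists W F, optimal I W F /\
     exists2 fs : seq ('I_(nvert I) * 'I_(nvert I)),
       perm_eq fs (enum F)
       & out = 1 :: flatten [seq [:: val e.1; val e.2] | e <- fs]) \/
  (out = [:: 0] /\ ~ exists W F, feasible I W F).

(* Main.v *)
Require Import Defs.
From mathcomp Require Import all_boot all_order all_algebra.
From mathcomp Require Import zify.

Set Implicit Arguments.
Unset Strict Implicit.
Unset Printing Implicit Defensive.

Import Order.TTheory GRing.Theory Num.Theory.

(* Put one token on each terminal and let the tokens climb to the root: always
   the topologically last occupied vertex [u] is vacated, all its tokens moving
   together along one arc [(v, u)] whose capacity is at least their number.
   Later moves only enter vertices strictly before [u], so no vertex is left
   twice, the arcs used form a tree, and the tokens carried by an arc are exactly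
   the terminals below it; conversely a feasible tree prescribes such moves along
   its own arcs.  Vertices are numbered injectively and increasingly along arcs by
   [pos v = rank * n + v < n^2], and a configuration of the [K] tokens is the
   number with base-[n^2] digits their positions.  A move decreases some digits
   and increases none, so one pass over the [n^(2K)] configurations in
   increasing order computes the cheapest sequence of moves from each of them.
   Lengths become integers after multiplication by the product of all
   denominators. *)

(** One parameter [G] controls the running time: every stored number stays below [2 ^ G] and every
    loop has at most [G] rounds, so a fixed program costs at most a fixed polynomial in [G]. Scaled
    costs may be exponential in the input size; only their number of digits has to be polynomial.
    For an input of [L] digits, [G = (L * L) ^ K + L * (L * L) + (L + L)] is enough. The first
    summand bounds the number of configurations, the second the number of rounds that compute the
    numbering. Since a configuration [x] has value at most [1 + x * 2 ^ (L + L)], the first and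
    third summands together bound the digits of all values. As [K] is fixed, [G] is a polynomial in
    [L]. *)

Lemma bitlen_le x k : x < 2 ^ k -> 0 < k -> bitlen x <= k.
Proof.
rewrite /bitlen => x_lt k_gt0; have [->|x_gt0] := posnP x; first by rewrite trunc_log0.
by rewrite -(ltn_exp2l _ _ (isT : 1 < 2)); apply: leq_ltn_trans x_lt; exact: trunc_logP.
Qed.

Lemma bitlen_gt x : x < 2 ^ bitlen x.
Proof. exact: trunc_log_ltn. Qed.

(** * Digit bounds and logarithmic cost of expressions *)

Section ExprCost.

(** A bound on the digits of the value, in units of [G]. Adding the bounds of the operands is right
    for products and generous for the other operations. *)
Fixpoint esize (e : expr) : nat :=
  match e with
  | Const n => n.+1
  | InputLength => 1
  | Input a | Fetch a => (esize a).+1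
  | Add a b | Defs.Sub a b | Mul a b | Div a b => esize a + esize b
  end.

Fixpoint eweight (e : expr) : nat :=
  esize e +
  match e with
  | Const _ | InputLength => 0
  | Input a | Fetch a => eweight a
  | Add a b | Defs.Sub a b | Mul a b | Div a b => eweight a + eweight b
  end.

Lemma esize_gt0 e : 0 < esize e.
Proof. by elim: e => //= a IHa b IHb; rewrite addn_gt0 IHa. Qed.

Variables (w : seq nat) (G : nat).
Hypothesis G_gt0 : 0 < G.
Hypothesis w_lt : forall i, nth 0 w i < 2 ^ G.
Hypothesis size_w : size w < 2 ^ G.

Definition bounded (m : memory) := forall a, m a < 2 ^ G.

Lemma eval_lt m e : bounded m -> eval w m e < 2 ^ (esize e * G).
Proof.
move=> m_lt; have mono a b : a <= b -> 2 ^ a <= 2 ^ b by move=> ?; rewrite leq_exp2l.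
elim: e => [n||a _|a _|a IHa b IHb|a IHa b IHb|a IHa b IHb|a IHa b IHb] /=.
- apply: (leq_trans (ltn_expl n (isT : 1 < 2))); apply: mono; nia.
- by rewrite mul1n.
- by apply: (leq_trans (w_lt _)); apply: mono; nia.
- by apply: (leq_trans (m_lt _)); apply: mono; nia.
- rewrite mulnDl expnD.
  (* If [x < A] and [y < B] with [A] and [B] at least 2, then [x + y < A * B]. *)
  have h e : 2 <= 2 ^ (esize e * G).
    by rewrite -[X in X <= _](expn1 2); apply: mono; rewrite muln_gt0 esize_gt0.
  have := h a; have := h b; nia.
- rewrite mulnDl expnD; apply: (leq_ltn_trans (leq_subr _ _)).
  by apply: (leq_trans IHa); rewrite leq_pmulr // expn_gt0.
- rewrite mulnDl expnD; nia.
- rewrite mulnDl expnD; apply: (leq_ltn_trans (leq_div _ _)).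
  by apply: (leq_trans IHa); rewrite leq_pmulr // expn_gt0.
Qed.

Lemma ecost_le m e : bounded m -> ecost w m e <= eweight e * G.
Proof.
move=> m_lt.
have h e' : bitlen (eval w m e') <= esize e' * G.
  by apply: bitlen_le; [exact: eval_lt | rewrite muln_gt0 esize_gt0].
have step e' c wt : c <= wt * G -> bitlen (eval w m e') + c <= (esize e' + wt) * G.
  by move=> ?; rewrite mulnDl leq_add.
elim: e => [n||a IHa|a IHa|a IHa b IHb|a IHa b IHb|a IHa b IHb|a IHa b IHb].
- exact: (step (Const n) 0 0).
- exact: (step InputLength 0 0).
- exact: (step (Input a)).
- exact: (step (Fetch a)).
- by apply: (step (Add a b)); rewrite mulnDl leq_add.
- by apply: (step (Defs.Sub a b)); rewrite mulnDl leq_add.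
- by apply: (step (Mul a b)); rewrite mulnDl leq_add.
- by apply: (step (Div a b)); rewrite mulnDl leq_add.
Qed.

End ExprCost.

(** * Programs with named regions and counted loops *)

Inductive region := Vars | Pos | Val | Choice | Next.

Definition rcode (j : region) : nat :=
  match j with Vars => 0 | Pos => 1 | Val => 2 | Choice => 3 | Next => 4 end.

Inductive term : Type :=
  | TConst of nat
  | TIn of term
  | TGet of region & term
  | TAdd of term & term
  | TSub of term & term
  | TMul of term & term
  | TDiv of term & term.

(* [PFor i e p] runs [p] with the variable [i] equal to [e - 1], ..., 1, 0. *)
Inductive prog : Type :=
  | PSkip
  | PSet of region & term & term
  | PWrite of term
  | PSeq of prog & prog
  | PIf of term & prog & prog
  | PFor of nat & term & prog.

Definition store := region -> nat -> nat.

Definition set (s : store) (j : region) (x v : nat) : store :=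
  fun j' x' => if (rcode j' == rcode j) && (x' == x) then v else s j' x'.

Fixpoint teval (w : seq nat) (s : store) (e : term) : nat :=
  match e with
  | TConst n => n
  | TIn a => nth 0 w (teval w s a)
  | TGet j a => s j (teval w s a)
  | TAdd a b => teval w s a + teval w s b
  | TSub a b => teval w s a - teval w s b
  | TMul a b => teval w s a * teval w s b
  | TDiv a b => teval w s a %/ teval w s b
  end.

(** The five unbounded arrays are interleaved by residue modulo 5, hence disjoint. *)
Definition address (j : region) (a : expr) : expr :=
  Add (Mul (Const 5) a) (Const (rcode j)).

Fixpoint tcomp (e : term) : expr :=
  match e with
  | TConst n => Const n
  | TIn a => Input (tcomp a)
  | TGet j a => Fetch (address j (tcomp a))
  | TAdd a b => Add (tcomp a) (tcomp b)
  | TSub a b => Defs.Sub (tcomp a) (tcomp b)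
  | TMul a b => Mul (tcomp a) (tcomp b)
  | TDiv a b => Div (tcomp a) (tcomp b)
  end.

Definition counter (i : nat) : expr := address Vars (Const i).

Definition pstore (j : region) (a e : term) : cmd :=
  Store (address j (tcomp a)) (tcomp e).

Fixpoint compile (p : prog) : cmd :=
  match p with
  | PSkip => Skip
  | PSet j a e => pstore j a e
  | PWrite e => Write (tcomp e)
  | PSeq p q => Seq (compile p) (compile q)
  | PIf e p q => If (tcomp e) (compile p) (compile q)
  | PFor i e p =>
      Seq (pstore Vars (TConst i) e)
        (While (Fetch (counter i))
           (Seq (pstore Vars (TConst i) (TSub (TGet Vars (TConst i)) (TConst 1)))
              (compile p)))
  end.

Definition swt (j : region) (a e : term) : nat :=
  eweight (address j (tcomp a)) + eweight (tcomp e).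

(** A conditional is charged for both branches and a loop for [G] rounds whatever its bound, so the
    estimate depends on [G] alone and not on the store. *)
Fixpoint ptime (p : prog) (G : nat) : nat :=
  match p with
  | PSkip => 1
  | PSet j a e => swt j a e * G
  | PWrite e => eweight (tcomp e) * G
  | PSeq p q => ptime p G + ptime q G
  | PIf e p q => eweight (tcomp e) * G + (ptime p G + ptime q G)
  | PFor i e p =>
      swt Vars (TConst i) e * G + eweight (Fetch (counter i)) * G
      + G * (eweight (Fetch (counter i)) * G
             + (swt Vars (TConst i) (TSub (TGet Vars (TConst i)) (TConst 1)) * G
                + ptime p G))
  end.

Lemma ptime_poly p : exists q : {poly nat}, forall G, ptime p G = q.[G]%R.
Proof.
have lin c : exists q : {poly nat}, forall G, c * G = q.[G]%R.
  by exists (c%:P * 'X)%R => G; rewrite hornerM hornerC hornerX.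
have add f g : (exists q : {poly nat}, forall G, f G = q.[G]%R) ->
    (exists q : {poly nat}, forall G, g G = q.[G]%R) ->
    exists q : {poly nat}, forall G, f G + g G = q.[G]%R.
  by case=> q1 h1 [q2 h2]; exists (q1 + q2)%R => G; rewrite hornerD h1 h2.
have mulX f : (exists q : {poly nat}, forall G, f G = q.[G]%R) ->
    exists q : {poly nat}, forall G, G * f G = q.[G]%R.
  by case=> q1 h1; exists ('X * q1)%R => G; rewrite hornerM hornerX h1.
elim: p => [|j a e|e|p IHp q IHq|e p IHp q IHq|i e p IHp] /=.
- by exists 1%R => G; rewrite hornerE.
- exact: lin.
- exact: lin.
- exact: (add (ptime p) (ptime q)).
- exact: (add (fun G => _) (fun G => ptime p G + ptime q G) (lin _) (add _ _ IHp IHq)).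
- apply: (add (fun G => _ + _) (fun G => G * _) (add _ _ (lin _) (lin _))).
  exact: (mulX _ (add _ _ (lin _) (add _ _ (lin _) IHp))).
Qed.

(** A computed address counts as touching its whole region. This is precise enough because variables
    have constant addresses and arrays are framed as wholes. *)
Fixpoint touches (p : prog) (j : region) (x : nat) : bool :=
  match p with
  | PSkip | PWrite _ => false
  | PSet j' a _ =>
      (rcode j == rcode j') && (if a is TConst v then x == v else true)
  | PSeq p q | PIf _ p q => touches p j x || touches q j x
  | PFor i _ p => (rcode j == 0) && (x == i) || touches p j x
  end.

Fixpoint writes (p : prog) : bool :=
  match p with
  | PSkip | PSet _ _ _ => false
  | PWrite _ => true
  | PSeq p q | PIf _ p q => writes p || writes q
  | PFor _ _ p => writes p
  end.

Definition frame (p : prog) (s : store) (o : seq nat) (s' : store) (o' : seq nat) :=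
  (forall j x, ~~ touches p j x -> s' j x = s j x) /\ (~~ writes p -> o' = o).

Lemma frame_refl p s o : frame p s o s o.
Proof. by []. Qed.

Definition represents (m : memory) (s : store) :=
  forall j x, m (5 * x + rcode j) = s j x.

Lemma represents_upd m s j x v :
  represents m s -> represents (upd m (5 * x + rcode j) v) (set s j x v).
Proof.
move=> ms j' x'; rewrite /upd /set.
have -> : (5 * x' + rcode j' == 5 * x + rcode j) = (rcode j' == rcode j) && (x' == x).
  have: rcode j < 5 by case: j.
  have: rcode j' < 5 by case: j'.
  lia.
by case: ifP.
Qed.

(** * Proof rules for total correctness with a time bound *)

Section Wp.

Variables (w : seq nat) (G : nat).
Hypothesis G_gt0 : 0 < G.
Hypothesis w_lt : forall i, nth 0 w i < 2 ^ G.
Hypothesis size_w : size w < 2 ^ G.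

Lemma eval_tcomp m s e : represents m s -> eval w m (tcomp e) = teval w s e.
Proof.
move=> ms; elim: e => //=; by [move=> a -> | move=> j a -> | move=> a -> b ->].
Qed.

(** Termination, time and the size of stored numbers are part of the predicate. The frame comes for
    free with every postcondition, so invariants need only mention cells that change. *)
Definition wp (p : prog) (Q : store -> seq nat -> Prop) (s : store) (o : seq nat) :=
  forall m, represents m s -> bounded G m ->
  exists t m' s' o',
    [/\ exec w (compile p) (m, o) t (m', o'), t <= ptime p G,
        represents m' s', bounded G m' & frame p s o s' o' /\ Q s' o'].

Lemma wp_mono p (Q Q' : store -> seq nat -> Prop) s o :
  wp p Q s o -> (forall s' o', frame p s o s' o' -> Q s' o' -> Q' s' o') ->
  wp p Q' s o.
Proof.
move=> H QQ' m ms mb; have [t [m' [s' [o' [? ? ? ? [fr q]]]]]] := H m ms mb.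
exists t, m', s', o'; split=> //; split=> //; exact: QQ'.
Qed.

Lemma wp_skip (Q : store -> seq nat -> Prop) s o : Q s o -> wp PSkip Q s o.
Proof. by move=> q m ms mb; exists 1, m, s, o; split=> //; exact: exec_skip. Qed.

Lemma bounded_upd m a v : bounded G m -> v < 2 ^ G -> bounded G (upd m a v).
Proof. by move=> mb v_lt b; rewrite /upd; case: ifP. Qed.

Lemma exec_pstore m s o j a e :
  represents m s -> bounded G m -> teval w s e < 2 ^ G ->
  exists t m', [/\ exec w (pstore j a e) (m, o) t (m', o), t <= swt j a e * G,
    represents m' (set s j (teval w s a) (teval w s e)) & bounded G m'].
Proof.
move=> ms mb e_lt; have := exec_store w (address j (tcomp a)) (tcomp e) m o.
have -> : eval w m (address j (tcomp a)) = 5 * teval w s a + rcode j.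
  by rewrite /= (eval_tcomp _ ms).
rewrite (eval_tcomp _ ms) => ex; do 2!eexists; split; first exact: ex.
- by rewrite /swt mulnDl leq_add // ecost_le.
- exact: represents_upd.
- exact: bounded_upd.
Qed.

Lemma frame_set s o j a e v :
  frame (PSet j a e) s o (set s j (teval w s a) v) o.
Proof.
split=> // j' x /=; rewrite /set negb_and; case: eqP => //= _.
by case: a => //= n /negbTE ->.
Qed.

Lemma wp_set (Q : store -> seq nat -> Prop) j a e s o :
  teval w s e < 2 ^ G -> Q (set s j (teval w s a) (teval w s e)) o ->
  wp (PSet j a e) Q s o.
Proof.
move=> e_lt q m ms mb; have [t [m' [? ? ? ?]]] := exec_pstore o j a ms mb e_lt.
by do 4!eexists; split; eauto; split; [exact: frame_set | exact: q].
Qed.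

Lemma wp_write (Q : store -> seq nat -> Prop) e s o :
  Q s (rcons o (teval w s e)) -> wp (PWrite e) Q s o.
Proof.
move=> q m ms mb; have := exec_write w (tcomp e) m o.
rewrite (eval_tcomp _ ms) => ex.
by exists (ecost w m (tcomp e)), m, s, (rcons o (teval w s e)); split=> //; exact: ecost_le.
Qed.

Lemma frame_seq p q s o s1 o1 s2 o2 :
  frame p s o s1 o1 -> frame q s1 o1 s2 o2 -> frame (PSeq p q) s o s2 o2.
Proof.
move=> [f1 g1] [f2 g2]; split=> [j x|] /=; rewrite negb_or => /andP[h1 h2].
  by rewrite f2 // f1.
by rewrite g2 // g1.
Qed.

Lemma wp_seq p q Q s o : wp p (wp q Q) s o -> wp (PSeq p q) Q s o.
Proof.
move=> H m ms mb; have [t [m1 [s1 [o1 [ex1 t_le ms1 mb1 [f1 H1]]]]]] := H m ms mb.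
have [t2 [m2 [s2 [o2 [ex2 t_le2 ms2 mb2 [f2 q2]]]]]] := H1 m1 ms1 mb1.
exists (t + t2), m2, s2, o2; split=> //; first exact: exec_seq ex1 ex2.
  exact: leq_add.
by split=> //; exact: frame_seq f1 f2.
Qed.

Lemma wp_if e p q Q s o :
  (teval w s e != 0 -> wp p Q s o) -> (teval w s e = 0 -> wp q Q s o) ->
  wp (PIf e p q) Q s o.
Proof.
move=> Hp Hq m ms mb.
have fr r s' o' : (r = p \/ r = q) -> frame r s o s' o' -> frame (PIf e p q) s o s' o'.
  by case=> -> [f1 g1]; split=> [j x|] /=; rewrite negb_or => /andP[h1 h2]; auto.
have [e0|en0] := eqVneq (teval w s e) 0.
- have [t [m1 [s1 [o1 [ex1 t_le ms1 mb1 [f1 H1]]]]]] := Hq e0 m ms mb.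
  exists (ecost w m (tcomp e) + t), m1, s1, o1; split=> //; last by split=> //; apply: fr f1; right.
    by apply: exec_if; rewrite /= (eval_tcomp _ ms) e0.
  by rewrite /= leq_add ?ecost_le // (leq_trans t_le) // leq_addl.
- have [t [m1 [s1 [o1 [ex1 t_le ms1 mb1 [f1 H1]]]]]] := Hp en0 m ms mb.
  exists (ecost w m (tcomp e) + t), m1, s1, o1; split=> //; last by split=> //; apply: fr f1; left.
    by apply: exec_if; rewrite /= (eval_tcomp _ ms) en0.
  by rewrite /= leq_add ?ecost_le // (leq_trans t_le) // leq_addr.
Qed.

(** [I k] holds when [k] rounds remain. The counter is decremented before the body runs, so the body
    leads from [I k.+1] to [I k] with counter [k]. The bound [n <= G] justifies the [G] rounds
    charged by [ptime]. *)
Lemma wp_for (I : nat -> store -> seq nat -> Prop) i e p Q s o :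
  let n := teval w s e in
  ~~ touches p Vars i -> n <= G -> I n (set s Vars i n) o ->
  (forall k s' o', k < n -> frame (PFor i e p) s o s' o' -> I k.+1 s' o' ->
     wp p (I k) (set s' Vars i k) o') ->
  (forall s' o', frame (PFor i e p) s o s' o' -> I 0 s' o' -> Q s' o') ->
  wp (PFor i e p) Q s o.
Proof.
move=> n ip n_le I0 body post m ms mb.
have n_lt : teval w s e < 2 ^ G by apply: leq_trans (ltn_expl G (isT : 1 < 2)); rewrite ltnS.
have [t1 [m1 [ex1 t1_le ms1 mb1]]] := exec_pstore o Vars (TConst i) ms mb n_lt.
set c1 := eweight (Fetch (counter i)).
set c2 := swt Vars (TConst i) (TSub (TGet Vars (TConst i)) (TConst 1)).
have fr_i s' o' k : frame (PFor i e p) s o s' o' ->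
    frame (PFor i e p) s o (set s' Vars i k) o'.
  case=> f1 g1; split=> // j x h; rewrite /set; case: ifP => [/andP[/eqP jV /eqP xi]|_].
    by rewrite /= jV xi !eqxx in h.
  exact: f1.
have loop : forall k s' o' m', k <= n -> represents m' s' -> bounded G m' -> s' Vars i = k ->
    frame (PFor i e p) s o s' o' -> I k s' o' ->
  exists t m2 s2 o2,
    [/\ exec w (While (Fetch (counter i)) (Seq (pstore Vars (TConst i)
          (TSub (TGet Vars (TConst i)) (TConst 1))) (compile p))) (m', o') t (m2, o2),
        t <= c1 * G + k * (c1 * G + (c2 * G + ptime p G)),
        represents m2 s2, bounded G m2 &
        frame (PFor i e p) s o s2 o2 /\ I 0 s2 o2].
  elim=> [|k IHk] s' o' m' k_le ms' mb' s'i fr Ik.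
    have ev : eval w m' (Fetch (counter i)) = 0.
      exact: etrans (eval_tcomp (TGet Vars (TConst i)) ms') s'i.
    exists (ecost w m' (Fetch (counter i))), m', s', o'; split=> //.
      by apply: exec_while_false.
    by rewrite mul0n addn0 ecost_le.
  have ev : eval w m' (Fetch (counter i)) = k.+1.
    exact: etrans (eval_tcomp (TGet Vars (TConst i)) ms') s'i.
  have ek : teval w s' (TSub (TGet Vars (TConst i)) (TConst 1)) = k.
    by rewrite /= s'i subn1.
  have k_lt : teval w s' (TSub (TGet Vars (TConst i)) (TConst 1)) < 2 ^ G.
    rewrite ek; apply: leq_ltn_trans n_lt; exact: ltnW.
  have [t2 [m2 [ex2 t2_le ms2 mb2]]] := exec_pstore o' Vars (TConst i) ms' mb' k_lt.
  rewrite ek in ms2.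
  have [t3 [m3 [s3 [o3 [ex3 t3_le ms3 mb3 [fr3 I3]]]]]] := body k s' o' k_le fr Ik m2 ms2 mb2.
  have fr3' : frame (PFor i e p) s o s3 o3.
    have [f1 g1] := fr_i _ _ k fr; have [f3 g3] := fr3; split=> [j x|] /=.
      by rewrite negb_or => /andP[h1 h2]; rewrite f3 // f1 //= negb_or h1.
    by move=> h; rewrite g3 // g1.
  have s3i : s3 Vars i = k by have [-> //] := fr3; rewrite /set !eqxx.
  have [t4 [m4 [s4 [o4 [ex4 t4_le ms4 mb4 [fr4 I4]]]]]] := IHk s3 o3 m3 (ltnW k_le) ms3 mb3 s3i fr3' I3.
  exists (ecost w m' (Fetch (counter i)) + (t2 + t3) + t4), m4, s4, o4; split=> //.
    apply: exec_while_true ex4; first by rewrite /= -/(eval w m' (Fetch (counter i))) ev.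
    exact: exec_seq ex2 ex3.
  have := ecost_le G_gt0 w_lt size_w (Fetch (counter i)) mb'.
  rewrite -/c1 in t4_le *; rewrite -/c2 in t2_le; rewrite mulSn.
  move: t2_le t3_le t4_le; set A := c1 * G; set B := c2 * G; set C := ptime p G.
  move=> *; lia.
have fr1 : frame (PFor i e p) s o (set s Vars i n) o by apply: fr_i; exact: frame_refl.
have s1i : set s Vars i n Vars i = n by rewrite /set !eqxx.
have [t2 [m2 [s2 [o2 [ex2 t2_le ms2 mb2 [fr2 I2]]]]]] := loop n _ o m1 (leqnn n) ms1 mb1 s1i fr1 I0.
exists (t1 + t2), m2, s2, o2; split=> //; first exact: exec_seq ex1 ex2.
  rewrite /= -/c1 -/c2 -addnA leq_add // (leq_trans t2_le) // leq_add2l.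
  by rewrite leq_mul2r n_le orbT.
by split=> //; exact: post.
Qed.

End Wp.

(** * The program *)

(* [Val] holds the optimal cost plus one, so that the initial 0 means that no
   plan is known; [Choice] and [Next] record the arc and the successor state. *)

Notation vE := 0 (only parsing).
Notation vJ := 1 (only parsing).
Notation vR := 2 (only parsing).
Notation vD := 3 (only parsing).
Notation vB := 4 (only parsing).
Notation vN := 5 (only parsing).
Notation vQ := 6 (only parsing).
Notation vS := 7 (only parsing).
Notation vAcc := 8 (only parsing).
Notation vRest := 9 (only parsing).
Notation vCnt := 10 (only parsing).
Notation vBad := 11 (only parsing).
Notation vHd := 12 (only parsing).
Notation vTl := 13 (only parsing).
Notation vX := 14 (only parsing).
Notation vStart := 15 (only parsing).
Notation vGoal := 16 (only parsing).
Notation vL := 17 (only parsing).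
Notation vCand := 18 (only parsing).

Definition TV (v : nat) : term := TGet Vars (TConst v).
Definition TI (i : nat) : term := TIn (TConst i).
Definition PV (v : nat) (e : term) : prog := PSet Vars (TConst v) e.

(** The input consists of four header words, the [TI 1] terminals, and five words per arc. *)
Definition Tfield (f : nat) (k : term) : term :=
  TIn (TAdd (TAdd (TConst (4 + f)) (TI 1)) (TMul (TConst 5) k)).
Definition Ttail := Tfield 0.
Definition Thead := Tfield 1.
Definition Tnum := Tfield 2.
Definition Tden := Tfield 3.
Definition Tcap := Tfield 4.

Definition prog_den : prog :=
  PSeq (PV vD (TConst 1)) (PFor vE (TI 2) (PV vD (TMul (TV vD) (Tden (TV vE))))).

(** Truncated subtraction is the comparison: the test is nonzero iff the head is not placed after
    the tail. Raising by [TI 0], the number of vertices, preserves the residue that identifies the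
    vertex. *)
Definition prog_relax : prog :=
  PIf (TSub (TAdd (TGet Pos (Ttail (TV vE))) (TConst 1)) (TGet Pos (Thead (TV vE))))
    (PSet Pos (Thead (TV vE)) (TAdd (TGet Pos (Thead (TV vE))) (TI 0)))
    PSkip.

Definition prog_pos : prog :=
  PSeq (PFor vE (TI 0) (PSet Pos (TV vE) (TV vE)))
    (PFor vR (TMul (TI 0) (TMul (TI 0) (TI 0))) (PFor vE (TI 2) prog_relax)).

Definition prog_init : prog :=
  PSeq (PV vB (TMul (TI 0) (TI 0)))
  (PSeq (PV vN (TConst 1))
  (PSeq (PV vStart (TConst 0))
  (PSeq (PV vGoal (TConst 0))
  (PFor vJ (TI 1)
    (PSeq (PV vStart (TAdd (TGet Pos (TIn (TAdd (TConst 4) (TV vJ)))) (TMul (TV vStart) (TV vB))))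
    (PSeq (PV vGoal (TAdd (TGet Pos (TI 3)) (TMul (TV vGoal) (TV vB))))
      (PV vN (TMul (TV vN) (TV vB))))))))).

(** The machine has neither a remainder nor an equality test: the lowest digit is obtained by
    multiplying back the quotient, and the sum of the two truncated differences vanishes iff the
    operands are equal. *)
Definition prog_digit : prog :=
  PSeq (PV vX (TSub (TV vRest) (TMul (TDiv (TV vRest) (TV vB)) (TV vB))))
  (PSeq (PV vRest (TDiv (TV vRest) (TV vB)))
  (PSeq
    (PIf (TAdd (TSub (TV vX) (TV vHd)) (TSub (TV vHd) (TV vX)))
      (PSeq (PV vAcc (TAdd (TV vAcc) (TMul (TV vX) (TV vQ))))
        (PIf (TSub (TV vX) (TV vHd)) (PV vBad (TConst 1)) PSkip))
      (PSeq (PV vAcc (TAdd (TV vAcc) (TMul (TV vTl) (TV vQ))))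
        (PV vCnt (TAdd (TV vCnt) (TConst 1)))))
    (PV vQ (TMul (TV vQ) (TV vB))))).

Definition prog_scan : prog :=
  PSeq (PV vHd (TGet Pos (Thead (TV vE))))
  (PSeq (PV vTl (TGet Pos (Ttail (TV vE))))
  (PSeq (PV vAcc (TConst 0))
  (PSeq (PV vCnt (TConst 0))
  (PSeq (PV vBad (TConst 0))
  (PSeq (PV vRest (TV vS))
  (PSeq (PV vQ (TConst 1))
    (PFor vJ (TI 1) prog_digit))))))).

(** A sum of naturals is nonzero iff some summand is, so the outer test is a disjunction of four
    reasons to reject the arc: a token beyond the head, no token on it, more tokens than the
    capacity, no plan known for the successor. *)
Definition prog_update : prog :=
  PIf (TAdd (TAdd (TV vBad) (TSub (TConst 1) (TV vCnt)))
        (TAdd (TSub (TV vCnt) (Tcap (TV vE))) (TSub (TConst 1) (TGet Val (TV vAcc)))))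
    PSkip
    (PSeq (PV vCand (TAdd (TGet Val (TV vAcc)) (TMul (Tnum (TV vE)) (TDiv (TV vD) (Tden (TV vE))))))
      (PIf (TAdd (TSub (TConst 1) (TGet Val (TV vS))) (TSub (TGet Val (TV vS)) (TV vCand)))
        (PSeq (PSet Val (TV vS) (TV vCand))
        (PSeq (PSet Choice (TV vS) (TV vE)) (PSet Next (TV vS) (TV vAcc))))
        PSkip)).

Definition prog_dp : prog :=
  PSeq (PSet Val (TV vGoal) (TConst 1))
  (PSeq (PV vS (TConst 0))
    (PFor vL (TV vN)
      (PSeq (PFor vE (TI 2) (PSeq prog_scan prog_update))
        (PV vS (TAdd (TV vS) (TConst 1)))))).

Definition prog_out : prog :=
  PIf (TGet Val (TV vStart))
    (PSeq (PWrite (TConst 1))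
    (PSeq (PV vS (TV vStart))
      (PFor vL (TV vN)
        (PIf (TAdd (TSub (TV vS) (TV vGoal)) (TSub (TV vGoal) (TV vS)))
          (PSeq (PWrite (Ttail (TGet Choice (TV vS))))
          (PSeq (PWrite (Thead (TGet Choice (TV vS))))
            (PV vS (TGet Next (TV vS)))))
          PSkip))))
    (PWrite (TConst 0)).

Definition steiner_prog : prog :=
  PSeq prog_den (PSeq prog_pos (PSeq prog_init (PSeq prog_dp prog_out))).

(** * Digit sequences *)

Section Digits.

Variable B : nat.

Definition code (ds : seq nat) : nat := foldr (fun x a => x + a * B) 0 ds.

Fixpoint digits (K x : nat) : seq nat :=
  if K is K'.+1 then x %% B :: digits K' (x %/ B) else [::].

Lemma size_digits K x : size (digits K x) = K.
Proof. by elim: K x => //= K IH x; rewrite IH. Qed.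

Lemma code_cat s1 s2 : code (s1 ++ s2) = code s1 + code s2 * B ^ size s1.
Proof.
elim: s1 => /= [|x s IH]; first by rewrite muln1.
by rewrite IH expnSr mulnDl addnA mulnA.
Qed.

Lemma code_lt ds : all (fun x => x < B) ds -> code ds < B ^ size ds.
Proof.
elim: ds => //= x ds IH /andP[x_lt /IH]; rewrite expnS; set c := code ds => c_lt.
have : (c + 1) * B <= B ^ size ds * B by rewrite leq_mul2r addn1 c_lt orbT.
rewrite mulnDl; lia.
Qed.

Lemma digitsK K x : x < B ^ K -> code (digits K x) = x.
Proof.
elim: K x => [|K IH] x /=; first by rewrite ltnS leqn0 => /eqP.
rewrite expnS => x_lt; rewrite IH; first by rewrite [RHS](divn_eq x B) addnC.
have B_gt0 : 0 < B by case: (B) x_lt.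
by rewrite ltn_divLR // mulnC.
Qed.

Lemma codeK ds : all (fun x => x < B) ds -> digits (size ds) (code ds) = ds.
Proof.
elim: ds => //= x ds IH /andP[x_lt h]; rewrite addnC modnMDl modn_small //.
by rewrite divnMDl ?(leq_ltn_trans _ x_lt) // divn_small // addn0 IH.
Qed.

Lemma digits_lt K x : 0 < B -> all (fun y => y < B) (digits K x).
Proof. by move=> B0; elim: K x => //= K IH x; rewrite ltn_mod B0 IH. Qed.

Definition replace (u v : nat) (ds : seq nat) : seq nat :=
  [seq if x == u then v else x | x <- ds].

Lemma code_replace_le u v ds : v < u -> code (replace u v ds) <= code ds.
Proof.
move=> vu; elim: ds => //= x ds IH; apply: leq_add; last by rewrite leq_mul2r IH orbT.
by case: eqP => // ->; exact: ltnW.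
Qed.

Lemma code_replace_lt u v ds : 0 < B -> v < u -> u \in ds -> code (replace u v ds) < code ds.
Proof.
move=> B0 vu; elim: ds => //= x ds IH; rewrite inE; have [<-|ne /=] := eqVneq u x => [_|/IH h].
  by rewrite -addSn leq_add // leq_mul2r code_replace_le // orbT.
by rewrite -addnS leq_add2l ltn_mul2r B0.
Qed.

End Digits.

(** * Common denominator, vertex numbering and initial configuration *)

Section Phases.

Variables (w : seq nat) (G : nat).
Hypothesis w_lt : forall i, nth 0 w i < 2 ^ G.
Hypothesis size_w : size w < 2 ^ G.
Hypothesis G_gt0 : 0 < G.

Let wpS := wp_for G_gt0 w_lt size_w.
Let wpV := wp_set G_gt0 w_lt size_w.
Let wpI := wp_if G_gt0 w_lt size_w.

Definition field (f k : nat) : nat := nth 0 w (4 + f + nth 0 w 1 + 5 * k).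
Definition nv := nth 0 w 0.
Definition nt := nth 0 w 1.
Definition na := nth 0 w 2.
Definition root_id := nth 0 w 3.
Definition term_at (j : nat) := nth 0 w (4 + j).
Definition arc_tail := field 0.
Definition arc_head := field 1.
Definition arc_num := field 2.
Definition arc_den := field 3.
Definition arc_cap := field 4.

Definition denprod := \prod_(0 <= k < na) arc_den k.

Lemma leq_G x : x <= G -> x < 2 ^ G.
Proof. by move=> ?; apply: leq_ltn_trans (ltn_expl G (isT : 1 < 2)). Qed.

Hypothesis na_le : na <= G.


Variable h : nat -> nat.
Hypothesis root_lt : root_id < nv.
Hypothesis arc_lt : forall k, k < na -> arc_tail k < nv /\ arc_head k < nv.
Hypothesis h_arc : forall k, k < na -> h (arc_tail k) < h (arc_head k).
Hypothesis h_lt : forall v, v < nv -> h v < nv.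
Hypothesis nv3_le : nv * (nv * nv) <= G.

Let nv_gt0 : 0 < nv.
Proof. exact: leq_ltn_trans root_lt. Qed.

Let nv2_le : nv * nv <= G.
Proof. by apply: leq_trans nv3_le; rewrite leq_pmull. Qed.

Let nv_le : nv <= G.
Proof. by apply: leq_trans nv2_le; rewrite leq_pmulr. Qed.

(** The index [a] describes a partial pass, since [PFor] visits the arcs from the last to the
    first. *)
Definition increasing_on_arcs (pos : nat -> nat) (a : nat) :=
  forall k, a <= k < na -> pos (arc_tail k) < pos (arc_head k).

(* [h v] bounds the number of times [v] can be raised. *)
Definition raised (pos : nat -> nat) :=
  forall v, v < nv -> pos v %% nv = v /\ pos v <= h v * nv + v.

Definition numbering (pos : nat -> nat) :=
  (forall v, v < nv -> pos v %% nv = v /\ pos v < nv * nv) /\ increasing_on_arcs pos 0.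

Definition possum (pos : nat -> nat) := \sum_(0 <= v < nv) pos v.

Lemma raised_lt pos v : raised pos -> v < nv -> pos v < nv * nv.
Proof.
move=> P v_lt; have [_ le] := P v v_lt; apply: leq_ltn_trans le _.
have : (h v + 1) * nv <= nv * nv by rewrite leq_mul2r addn1 h_lt // orbT.
by rewrite mulnDl; lia.
Qed.

Lemma possum_lt pos : raised pos -> possum pos < nv * (nv * nv).
Proof.
move=> P; have : possum pos <= \sum_(0 <= v < nv) (nv * nv).-1.
  rewrite /possum big_seq_cond [leqRHS]big_seq_cond; apply: leq_sum => v.
  rewrite andbT mem_index_iota => /andP[_ v_lt]; have := raised_lt P v_lt; lia.
rewrite sum_nat_const_nat subn0 => le; apply: leq_ltn_trans le _.
by rewrite ltn_pmul2l // prednK // muln_gt0 nv_gt0.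
Qed.

(** Write a position as [q * nv + v]. On a violated arc the quotient of the head is at most that of
    the tail, hence at most [h] of the tail, which is less than [h] of the head. So there is room
    for one more raise. *)
Lemma raised_step pos pos' k : raised pos -> k < na -> pos (arc_head k) <= pos (arc_tail k) ->
  (forall v, pos' v = if v == arc_head k then pos v + nv else pos v) ->
  raised pos' /\ possum pos' = possum pos + nv.
Proof.
move=> P k_lt viol E; have [t_lt d_lt] := arc_lt k_lt; split.
  move=> v v_lt; rewrite E; case: eqP => [vE|_]; last exact: P.
  have [md le] := P v v_lt; rewrite modnDr; split=> //.
  have [mdt let_] := P _ t_lt; rewrite -vE in viol.
  have hh := h_arc k_lt; rewrite -vE in hh.
  rewrite (divn_eq (pos v) nv) md in viol le *.
  rewrite (divn_eq (pos (arc_tail k)) nv) mdt in viol let_.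
  move: (pos v %/ nv) (pos (arc_tail k) %/ nv) viol le let_ => a b viol le let_.
  have ab : a <= b.
    by rewrite leqNgt; apply/negP => ba; have := leq_mul ba (leqnn nv); rewrite mulSn; lia.
  have bh : b <= h (arc_tail k) by rewrite -(leq_pmul2r nv_gt0); lia.
  have := leq_mul (leq_ltn_trans (leq_trans ab bh) hh) (leqnn nv).
  by rewrite mulSn; lia.
have d_in : arc_head k \in index_iota 0 nv by rewrite mem_index_iota.
rewrite /possum !(bigD1_seq (arc_head k) d_in) ?iota_uniq //= E eqxx addnAC; congr (_ + _ + _).
by apply: eq_bigr => v /negbTE; rewrite E => ->.
Qed.

(** The first alternative remembers that the numbering was not increasing before the pass. Once it
    is increasing, only the second alternative is left, and further passes change nothing. *)
Lemma wp_relax_arcs s o : raised (s Pos) ->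
  wp w G (PFor vE (TI 2) prog_relax)
    (fun s' _ => raised (s' Pos) /\
       ((~ increasing_on_arcs (s Pos) 0 /\ possum (s Pos) < possum (s' Pos))
        \/ possum (s' Pos) = possum (s Pos) /\ increasing_on_arcs (s' Pos) 0)) s o.
Proof.
move=> P0.
apply: (wpS (I := fun a s' _ => raised (s' Pos) /\
       ((~ increasing_on_arcs (s Pos) 0 /\ possum (s Pos) < possum (s' Pos))
        \/ (forall v, s' Pos v = s Pos v) /\ increasing_on_arcs (s' Pos) a))) => //=.
- by split=> //; right; split=> // k; rewrite -/na; lia.
- move=> k s' o' k_lt _ [P Q]; rewrite -/na in k_lt.
  set s1 := set _ _ _ _.
  have Et : teval w s1 (Ttail (TV vE)) = arc_tail k by [].
  have Eh : teval w s1 (Thead (TV vE)) = arc_head k by [].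
  have Ev : teval w s1 (TSub (TAdd (TGet Pos (Ttail (TV vE))) (TConst 1)) (TGet Pos (Thead (TV vE))))
            = s' Pos (arc_tail k) + 1 - s' Pos (arc_head k) by [].
  apply: wpI; rewrite Ev => C.
    have viol : s' Pos (arc_head k) <= s' Pos (arc_tail k) by lia.
    have [_ hd_lt] := arc_lt k_lt.
    have [P' S'] := raised_step
      (pos' := set s1 Pos (arc_head k) (s' Pos (arc_head k) + nv) Pos) P k_lt viol
      (fun v => ltac:(by rewrite /set /=; case: eqP => [->|])).
    apply: wpV.
      apply: leq_G; apply: leq_trans nv2_le; apply: ltnW.
      have := raised_lt P' hd_lt; by rewrite /set /= eqxx.
    rewrite Eh; split=> //; left.
    have -> : teval w s1 (TAdd (TGet Pos (Thead (TV vE))) (TI 0)) = s' Pos (arc_head k) + nv by [].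
    rewrite S'; case: Q => [[ns lt]|[eqP_ _]].
      by split=> //; apply: ltn_trans lt _; rewrite -addn1 leq_add2l.
    have -> : possum (s' Pos) = possum (s Pos) by apply: eq_bigr => v _; rewrite eqP_.
    split; last by rewrite -addn1 leq_add2l.
    by move=> /(_ k k_lt); rewrite -!eqP_; lia.
  apply: wp_skip; split=> //; case: Q => [?|[eqP_ inc]]; [by left | right; split=> //].
  move=> l /andP[]; rewrite leq_eqVlt => /orP[/eqP <- _|kl l_lt]; first by rewrite /s1 /set /=; lia.
  by apply: inc; rewrite kl.
- move=> s' o' _ [P [H|[E I]]]; split=> //; [by left | right; split=> //].
  by apply: eq_bigr => v _; rewrite E.
Qed.

(** The sum of positions is a potential: a pass over a numbering that is not yet increasing raises
    it, and it stays below [nv * (nv * nv)]. That many rounds therefore suffice without any test for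
    stability. *)
Lemma wp_pos s o : wp w G prog_pos (fun s' _ => numbering (s' Pos)) s o.
Proof.
apply: wp_seq.
apply: (wpS (I := fun k s' _ => forall v, k <= v < nv -> s' Pos v = v)) => //=.
- by move=> v; rewrite -/nv; lia.
- move=> k s' o' k_lt _ H; rewrite -/nv in k_lt; apply: wpV => /=.
    by apply: leq_G; apply: leq_trans nv_le; exact: ltnW.
  move=> v /andP[kv v_lt]; rewrite /set /=; case: eqP => // ne; apply: H; lia.
move=> s1 o1 _ H1.
apply: (wpS (I := fun k s' _ => raised (s' Pos) /\
    (increasing_on_arcs (s' Pos) 0 \/ nv * (nv * nv) <= possum (s' Pos) + k))) => //.
- split; last by right; rewrite leq_addl.
  by move=> v v_lt; rewrite /set /= H1 //= modn_small // leq_addl.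
- move=> k s' o' k_lt _ [P Q].
  apply: wp_mono; first exact: wp_relax_arcs.
  move=> s2 o2 _ [P2 Q2]; split=> //; case: Q2 => [[ns lt]|[_ ?]]; last by left.
  right; case: Q => [inc|le]; first by case: ns.
  move: lt le; rewrite -[possum (set _ _ _ _ _)]/(possum (s' Pos)); lia.
move=> s' o' _ [P [inc|le]]; last by have := possum_lt P; lia.
split=> // v v_lt; split; [exact: (P v v_lt).1 | exact: raised_lt].
Qed.

Variable pos : nat -> nat.
Hypothesis pos_lt : forall v, v < nv -> pos v < nv * nv.
Hypothesis term_lt : forall j, j < nt -> term_at j < nv.
Hypothesis nt_le : nt <= G.

Definition base := nv * nv.
Definition start := [seq pos (term_at j) | j <- iota 0 nt].
Definition goal := nseq nt (pos root_id).

Hypothesis states_le : base ^ nt <= G.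

Lemma wp_init s o : (forall v, v < nv -> s Pos v = pos v) ->
  wp w G prog_init (fun s' _ => [/\ s' Vars vB = base, s' Vars vN = base ^ nt,
     s' Vars vStart = code base start & s' Vars vGoal = code base goal]) s o.
Proof.
move=> Hpos; have base_gt0 : 0 < base by rewrite muln_gt0 nv_gt0.
apply: wp_seq; apply: wpV; first exact: leq_G.
apply: wp_seq; apply: wpV; first exact: leq_G.
apply: wp_seq; apply: wpV; first exact: leq_G.
apply: wp_seq; apply: wpV; first exact: leq_G.
set s1 := set _ _ _ _.
apply: (wpS (I := fun k s' _ => [/\ s' Vars vN = base ^ (nt - k),
   s' Vars vStart = code base [seq pos (term_at j) | j <- iota k (nt - k)]
   & s' Vars vGoal = code base (nseq (nt - k) (pos root_id))])) => //.
- by rewrite /= -/nt subnn.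
- move=> k s' o' k_lt [fr _] [HN HS HG]; rewrite /= -/nt in k_lt.
  have frP v : v < nv -> s' Pos v = pos v by move=> v_lt; rewrite fr // -Hpos.
  have frB : s' Vars vB = base by rewrite fr.
  have ds_lt : all (fun x => x < base) [seq pos (term_at j) | j <- iota k (nt - k)].
    apply/allP => x /mapP[j]; rewrite mem_iota => /andP[kj j_lt] ->.
    by apply: pos_lt; apply: term_lt; move: j_lt; rewrite subnKC // ltnW.
  have eqk : nt - k = (nt - k.+1).+1 by lia.
  have code_G ds : size ds = nt - k -> all (fun x => x < base) ds -> code base ds < 2 ^ G.
    move=> sz dl; apply: leq_G; apply: leq_trans states_le; apply: ltnW.
    apply: leq_trans (code_lt dl) _; rewrite sz leq_pexp2l //; lia.
  set s2 := set s' _ _ _.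
  have E1 : teval w s2 (TAdd (TGet Pos (TIn (TAdd (TConst 4) (TV vJ)))) (TMul (TV vStart) (TV vB)))
     = code base [seq pos (term_at j) | j <- iota k (nt - k)].
    by rewrite eqk /= /s2 /set /= HS frB -/(term_at k) frP // term_lt.
  apply: wp_seq; apply: wpV; first by rewrite E1 code_G // size_map size_iota.
  rewrite E1; set s3 := set s2 _ _ _.
  have E2 : teval w s3 (TAdd (TGet Pos (TI 3)) (TMul (TV vGoal) (TV vB)))
     = code base (nseq (nt - k) (pos root_id)).
    by rewrite eqk /= /s3 /s2 /set /= HG frB -/root_id frP.
  apply: wp_seq; apply: wpV.
    by rewrite E2 code_G // ?size_nseq // all_nseq pos_lt ?orbT.
  rewrite E2; set s4 := set s3 _ _ _.
  have E3 : teval w s4 (TMul (TV vN) (TV vB)) = base ^ (nt - k).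
    by rewrite eqk expnSr /= /s4 /s3 /s2 /set /= HN frB.
  apply: wpV; last by rewrite E3; split.
  by rewrite E3; apply: leq_G; apply: leq_trans states_le; rewrite leq_pexp2l // leq_subr.
- move=> s' o' [fr _]; rewrite subn0 => -[HN HS HG]; split=> //.
  by rewrite fr.
Qed.

Hypothesis den_gt0 : forall k, k < na -> 0 < arc_den k.
Hypothesis denprod_lt : denprod < 2 ^ G.

Lemma wp_den s o : wp w G prog_den (fun s' _ => s' Vars vD = denprod) s o.
Proof.
apply: wp_seq; apply: wpV => /=; first exact: leq_G.
apply: (wpS (I := fun k s' _ => s' Vars vD = \prod_(k <= i < na) arc_den i)) => //=.
- by rewrite /set /= big_geq.
- move=> k s' o' k_lt [fr _]; rewrite -/na in k_lt => Hk.
  have E : teval w (set s' Vars 0 k) (TMul (TV vD) (Tden (TV vE))) = \prod_(k <= i < na) arc_den i.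
    by rewrite /= /set /= Hk (big_ltn k_lt) mulnC.
  apply: wpV => //; rewrite E.
  apply: leq_ltn_trans denprod_lt; rewrite /denprod (@big_cat_nat _ _ _ k 0 na) //=; last exact: ltnW.
  apply: leq_pmull; rewrite big_seq_cond; apply: prodn_cond_gt0 => i.
  by rewrite andbT mem_index_iota => /andP[_ ik]; apply: den_gt0; exact: ltn_trans k_lt.
Qed.

End Phases.

(** * Plans on digit codes and the recurrence for their cost *)

Section Plans.

Variables (w : seq nat) (pos : nat -> nat).

Definition hd (k : nat) := pos (arc_head w k).
Definition tl (k : nat) := pos (arc_tail w k).
Definition weight (k : nat) := arc_num w k * (denprod w %/ arc_den w k).

Definition movable (ds : seq nat) (k : nat) :=
  [&& all (fun y => y <= hd k) ds, hd k \in ds & count_mem (hd k) ds <= arc_cap w k].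
Definition move (ds : seq nat) (k : nat) := replace (hd k) (tl k) ds.

Fixpoint plan (ds ks : seq nat) : bool :=
  if ks is k :: ks' then [&& k < na w, movable ds k & plan (move ds k) ks']
  else ds == goal w pos.

Definition ds_of (x : nat) := digits (base w) (nt w) x.
Definition mv (x k : nat) := code (base w) (move (ds_of x) k).

Fixpoint planc (x : nat) (ks : seq nat) : bool :=
  if ks is k :: ks' then [&& k < na w, movable (ds_of x) k & planc (mv x k) ks']
  else x == code (base w) (goal w pos).

Definition cost (ks : seq nat) := \sum_(k <- ks) weight k.

Hypothesis base_gt0 : 0 < base w.
Hypothesis tl_lt : forall k, k < na w -> tl k < hd k.
Hypothesis hd_lt : forall k, k < na w -> hd k < base w.
Hypothesis root_lt : pos (root_id w) < base w.
Hypothesis hd_root : forall k, k < na w -> hd k != pos (root_id w).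

Definition nstates := base w ^ nt w.
Definition cgoal := code (base w) (goal w pos).

Lemma all_move ds k : k < na w -> all (fun x => x < base w) ds ->
  all (fun x => x < base w) (move ds k).
Proof.
move=> k_lt /allP H; apply/allP => _ /mapP[y y_in ->]; case: ifP => _; last exact: H.
by apply: ltn_trans (tl_lt k_lt) (hd_lt k_lt).
Qed.

(** The number of digits is fixed, so a code determines its configuration even when leading digits
    are 0. *)
Lemma planc_code ds ks : size ds = nt w -> all (fun x => x < base w) ds ->
  planc (code (base w) ds) ks = plan ds ks.
Proof.
have goal_lt : all (fun x => x < base w) (goal w pos) by rewrite all_nseq root_lt orbT.
elim: ks ds => /= [|k ks IH] ds sz lt.
  apply/eqP/eqP => [E|-> //].
  by rewrite -(codeK lt) E sz -(size_nseq (nt w) (pos (root_id w))) codeK.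
rewrite /mv /ds_of -sz codeK //; case: (ltnP k (na w)) => //= k_lt.
by rewrite IH ?size_map ?all_move.
Qed.

Lemma ds_of_lt x : all (fun y => y < base w) (ds_of x).
Proof. exact: digits_lt. Qed.

Lemma mv_lt x k : k < na w -> x < nstates -> movable (ds_of x) k -> mv x k < x.
Proof.
move=> k_lt x_lt /and3P[_ h _]; rewrite -[X in _ < X](digitsK x_lt).
by apply: code_replace_lt => //; exact: tl_lt.
Qed.

Lemma mv_lt_states x k : k < na w -> mv x k < nstates.
Proof.
move=> k_lt; have := code_lt (all_move k_lt (ds_of_lt x)).
by rewrite size_map size_digits.
Qed.

Lemma cgoal_lt : cgoal < nstates.
Proof.
have := @code_lt (base w) (goal w pos); rewrite size_nseq; apply.
by rewrite all_nseq root_lt orbT.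
Qed.

(** At the goal all tokens are on the root, which no arc enters. This protects the value preset at
    [cgoal] from being overwritten. *)
Lemma movable_goal k : k < na w -> ~~ movable (ds_of cgoal) k.
Proof.
move=> k_lt; apply/negP => /and3P[_ + _]; rewrite /ds_of /cgoal.
rewrite -{1}(size_nseq (nt w) (pos (root_id w))) codeK ?all_nseq ?root_lt ?orbT //.
by rewrite mem_nseq (negbTE (hd_root k_lt)) andbF.
Qed.

Variable big : nat.

(* [V], [C] and [X] stand for [Val], [Choice] and [Next]; only the arcs of index at
   least [a] have been tried at [x], because [PFor] counts down. *)
Definition settled (V C X : nat -> nat) (x a : nat) :=
  [/\ V x = 0 \/ x = cgoal \/
        [/\ C x < na w, movable (ds_of x) (C x), X x = mv x (C x), V (X x) != 0
          & V x = V (X x) + weight (C x)],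
      (forall k, a <= k < na w -> movable (ds_of x) k -> V (mv x k) != 0 ->
         0 < V x <= V (mv x k) + weight k)
    & V x <= 1 + x * big].

(** Moves lead to smaller codes, so being settled at [x] depends only on entries up to [x] and
    survives all later work. *)
Lemma settled_eq V C X V' C' X' x a : x < nstates ->
  (forall y, y <= x -> [/\ V' y = V y, C' y = C y & X' y = X y]) ->
  settled V C X x a -> settled V' C' X' x a.
Proof.
move=> x_lt E [h1 h2 h3]; have [Ex Cx Xx] := E x (leqnn x); split; rewrite ?Ex //.
  case: h1 => [?|[?|[C_lt ok XE V0 VE]]]; [by left | by right; left | right; right].
  have [EX _ _] : [/\ V' (X x) = V (X x), C' (X x) = C (X x) & X' (X x) = X (X x)].
    by apply: E; rewrite XE ltnW // mv_lt.
  by rewrite Cx Xx EX.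
move=> k /andP[ak k_lt] ok.
have [Em _ _] : [/\ V' (mv x k) = V (mv x k), C' (mv x k) = C (mv x k) & X' (mv x k) = X (mv x k)].
  by apply: E; rewrite ltnW // mv_lt.
by rewrite Em; apply: h2; rewrite ?ak.
Qed.

(** Only half of optimality: no plan is cheaper than the table says. That the value is attained
    follows in [wp_out] by tracing [Next]. *)
Lemma settled_le V C X : (forall x, x < nstates -> settled V C X x 0) -> V cgoal = 1 ->
  forall ks x, x < nstates -> planc x ks -> 0 < V x <= 1 + cost ks.
Proof.
move=> H Vg; elim=> [|k ks IH] x x_lt /=; first by move=> /eqP ->; rewrite -/cgoal Vg.
case/and3P => k_lt ok /(IH _ (mv_lt_states _ k_lt)) /andP[V0 le].
have [_ h2 _] := H x x_lt; have := h2 k k_lt ok; rewrite -lt0n => /(_ V0) /andP[-> le2] /=.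
by rewrite /cost big_cons -/(cost ks); lia.
Qed.

End Plans.

(** * Correctness of the table computation and of the traceback *)

Section DP.

Variables (w : seq nat) (G : nat).
Hypothesis w_lt : forall i, nth 0 w i < 2 ^ G.
Hypothesis size_w : size w < 2 ^ G.
Hypothesis G_gt0 : 0 < G.

Let wpS := wp_for G_gt0 w_lt size_w.
Let wpV := wp_set G_gt0 w_lt size_w.
Let wpI := wp_if G_gt0 w_lt size_w.
Let wpW := wp_write G_gt0 w_lt size_w.

Variable pos : nat -> nat.
Local Notation hd := (hd w pos).
Local Notation tl := (tl w pos).
Local Notation weight := (weight w).
Local Notation B := (base w).
Local Notation K := (nt w).
Local Notation N := (nstates w).
Local Notation cgoal := (cgoal w pos).
Local Notation ds_of := (ds_of w).
Local Notation mv := (mv w pos).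
Local Notation movable := (movable w pos).

Hypothesis base_gt0 : 0 < B.
Hypothesis arc_lt : forall k, k < na w -> arc_tail w k < nv w /\ arc_head w k < nv w.
Hypothesis tl_lt : forall k, k < na w -> tl k < hd k.
Hypothesis hd_lt : forall k, k < na w -> hd k < B.
Hypothesis root_lt : pos (root_id w) < B.
Hypothesis hd_root : forall k, k < na w -> hd k != pos (root_id w).
Hypothesis nt_gt0 : 0 < K.
Hypothesis nt_le : K <= G.
Hypothesis na_le : na w <= G.
Hypothesis states_le : N <= G.
Variable big : nat.
Hypothesis big_gt0 : 0 < big.
Hypothesis weight_le : forall k, k < na w -> weight k <= big.
Hypothesis value_lt : N * big < 2 ^ G.

Lemma wp_scan s o k x : k < na w -> x < N ->
  s Vars vE = k -> s Vars vS = x -> s Vars vB = B ->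
  (forall v, v < nv w -> s Pos v = pos v) ->
  wp w G prog_scan (fun s' _ =>
    [/\ s' Vars vAcc = mv x k, s' Vars vCnt = count_mem (hd k) (ds_of x)
      & (s' Vars vBad == 0) = all (fun y => y <= hd k) (ds_of x)]) s o.
Proof.
move=> k_lt x_lt sE sS sB sP; have [t_lt d_lt] := arc_lt k_lt.
have B_le : B <= N by rewrite -[X in X <= _]expn1 leq_pexp2l.
have ltG y : y <= N -> y < 2 ^ G by move=> ?; apply: leq_G; exact: leq_trans states_le.
have ltB y : y < B -> y < 2 ^ G by move=> ?; apply: ltG; apply: leq_trans B_le; exact: ltnW.
have N_gt0 : 0 < N by exact: leq_ltn_trans x_lt.
have eh : teval w s (TGet Pos (Thead (TV vE))) = hd k by rewrite /hd -sP // -sE.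
have et : teval w (set s Vars vHd (hd k)) (TGet Pos (Ttail (TV vE))) = tl k.
  by rewrite /tl -sP // -sE.
apply: wp_seq; apply: wpV; rewrite eh; first by apply/ltB/hd_lt.
apply: wp_seq; apply: wpV; rewrite et; first by apply/ltB; apply: ltn_trans (hd_lt k_lt); exact: tl_lt.
apply: wp_seq; apply: wpV; first exact: leq_G.
apply: wp_seq; apply: wpV; first exact: leq_G.
apply: wp_seq; apply: wpV; first exact: leq_G.
apply: wp_seq; apply: wpV; first by rewrite /= /set /= sS; apply/ltG/ltnW.
apply: wp_seq; apply: wpV; first exact: leq_G.
set s1 := set _ _ _ _.
set ds := ds_of x; have ds_lt : all (fun y => y < B) ds by apply: ds_of_lt.
have ds_size : size ds = K by exact: size_digits.
(* The low digits [ds1] have been treated and [ds2] remain; [vQ] is the weight of the next digit. *)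
apply: (wpS (I := fun j s' _ => exists ds1 ds2,
   [/\ ds = ds1 ++ ds2, size ds2 = j, s' Vars vRest = code B ds2,
     s' Vars vQ = B ^ size ds1 & s' Vars vAcc = code B (move w pos ds1 k)]
   /\ s' Vars vCnt = count_mem (hd k) ds1
   /\ (s' Vars vBad == 0) = all (fun y => y <= hd k) ds1)) => //.
- exists [::], ds; split=> //; split=> //; rewrite /s1 /set /= sS; exact/esym/digitsK.
- move=> j s' o' j_lt [fr _] [ds1 [ds2 [[dsE sz2 HR HQ HA] [HC Hb]]]].
  case: ds2 dsE sz2 HR => [//|y ds2] dsE [sz2] HR.
  have frB : s' Vars vB = B by rewrite fr // /s1 /set /=.
  have frH : s' Vars vHd = hd k by rewrite fr // /s1 /set /=.
  have frT : s' Vars vTl = tl k by rewrite fr // /s1 /set /=.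
  have /and3P[lt1 y_lt lt2] : [&& all (fun y => y < B) ds1, y < B & all (fun y => y < B) ds2].
    by move: ds_lt; rewrite dsE all_cat /=.
  have szK : size ds1 + (size ds2).+1 = K by rewrite -ds_size dsE size_cat.
  have c2_lt : code B ds2 <= N.
    by apply: ltnW; apply: leq_trans (code_lt lt2) _; rewrite leq_pexp2l //; lia.
  have divE : code B (y :: ds2) %/ B = code B ds2.
    by rewrite /= addnC divnMDl // divn_small // addn0.
  have q_le : B ^ (size ds1).+1 <= N by rewrite leq_pexp2l //; lia.
  pose z := if y == hd k then tl k else y.
  have accE : code B (move w pos (rcons ds1 y) k) = code B (move w pos ds1 k) + z * B ^ size ds1.
    by rewrite /move /replace -cats1 map_cat code_cat size_map /= mul0n addn0.
  have acc_lt : code B (move w pos ds1 k) + z * B ^ size ds1 <= N.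
    rewrite -accE; apply: ltnW; apply: leq_trans (code_lt (all_move tl_lt hd_lt k_lt _)) _.
      by rewrite all_rcons y_lt.
    by rewrite size_map size_rcons.
  set s2 := set s' _ _ _.
  have E2 : teval w s2 (TSub (TV vRest) (TMul (TDiv (TV vRest) (TV vB)) (TV vB))) = y.
    by rewrite /= /s2 /set /= HR frB divE /= addnK.
  apply: wp_seq; apply: wpV; rewrite E2; first exact: ltB.
  set s3 := set s2 _ _ _.
  have E3 : teval w s3 (TDiv (TV vRest) (TV vB)) = code B ds2.
    by rewrite /= /s3 /s2 /set /= HR frB divE.
  apply: wp_seq; apply: wpV; rewrite E3; first exact: ltG.
  apply: wp_seq; set s4 := set _ _ _ _.
  (* The cases of a digit above, below or equal to the head join here: whichever branch was taken,
     these equations re-establish the invariant with [y] moved to [ds1]. *)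
  have post s5 o5 :
     s5 Vars vRest = code B ds2 -> s5 Vars vQ = B ^ size ds1 -> s5 Vars vB = B ->
     s5 Vars vAcc = code B (move w pos ds1 k) + z * B ^ size ds1 ->
     s5 Vars vCnt = count_mem (hd k) ds1 + (y == hd k) ->
     (s5 Vars vBad == 0) = all (fun y => y <= hd k) ds1 && (y <= hd k) ->
     wp w G (PV vQ (TMul (TV vQ) (TV vB))) (fun s' _ => exists ds1 ds2,
       [/\ ds = ds1 ++ ds2, size ds2 = j, s' Vars vRest = code B ds2,
         s' Vars vQ = B ^ size ds1 & s' Vars vAcc = code B (move w pos ds1 k)]
       /\ s' Vars vCnt = count_mem (hd k) ds1
       /\ (s' Vars vBad == 0) = all (fun y => y <= hd k) ds1) s5 o5.
    move=> R5 Q5 B5 A5 C5 b5; apply: wpV.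
      by rewrite /= Q5 B5 -expnSr; exact: ltG.
    exists (rcons ds1 y), ds2; rewrite /set /= Q5 B5 R5 A5 C5 b5.
    rewrite cat_rcons size_rcons expnSr accE all_rcons andbC -cats1 count_cat /= addn0.
    by [].
  have s4X : s4 Vars vX = y by [].
  have s4H : s4 Vars vHd = hd k by rewrite /s4 /s3 /s2 /set /=.
  have s4T : s4 Vars vTl = tl k by rewrite /s4 /s3 /s2 /set /=.
  have s4Q : s4 Vars vQ = B ^ size ds1 by rewrite /s4 /s3 /s2 /set /=.
  have s4A : s4 Vars vAcc = code B (move w pos ds1 k) by rewrite /s4 /s3 /s2 /set /=.
  have s4C : s4 Vars vCnt = count_mem (hd k) ds1 by rewrite /s4 /s3 /s2 /set /=.
  have s4b : (s4 Vars vBad == 0) = all (fun y => y <= hd k) ds1 by rewrite /s4 /s3 /s2 /set /=.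
  have s4B : s4 Vars vB = B by rewrite /s4 /s3 /s2 /set /=.
  have s4R : s4 Vars vRest = code B ds2 by rewrite /s4 /s3 /s2 /set /=.
  have zne : y != hd k -> z = y by rewrite /z => /negbTE ->.
  have zeq : y = hd k -> z = tl k by rewrite /z => ->; rewrite eqxx.
  clearbody s4; apply: wpI; rewrite /= s4X s4H => Cd.
    have ne : y != hd k by lia.
    apply: wp_seq; apply: wpV => /=; rewrite s4A s4X s4Q -(zne ne); first exact: ltG.
    apply: wpI; rewrite /= /set /= s4X s4H => Cd2.
      apply: wpV; first exact: leq_G.
      apply: post; rewrite /set //= ?(negbTE ne) ?addn0 //.
      by apply/esym; rewrite leqNgt; apply/negP => /andP[_]; lia.
    apply: wp_skip; apply: post; rewrite /set //= ?(negbTE ne) ?addn0 //.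
    have le : y <= hd k by lia.
    by rewrite s4b le andbT.
  have yE : y = hd k by lia.
  apply: wp_seq; apply: wpV => /=; rewrite s4A s4T s4Q -(zeq yE); first exact: ltG.
  have cnt_le : count_mem (hd k) ds1 + 1 <= K.
    by rewrite -szK addn1 addnS ltnS; apply: leq_trans (count_size _ _) (leq_addr _ _).
  apply: wpV; first by rewrite /= /set /= s4C; apply: leq_G; exact: leq_trans nt_le.
  apply: post; rewrite /set //= ?yE ?eqxx ?leqnn ?andbT ?s4C //.
- move=> s' o' _ [ds1 [ds2 [[dsE /size0nil ds2E _ _ HA] [HC Hb]]]].
  by rewrite ds2E cats0 in dsE; rewrite HA HC Hb -dsE.
Qed.


(** Values above [x] are still initial, so every state other than the preset goal begins its turn
    with no plan known. *)
Definition dpinv (x a : nat) (s : store) :=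
  [/\ forall y, y < x -> settled w pos big (s Val) (s Choice) (s Next) y 0,
      settled w pos big (s Val) (s Choice) (s Next) x a,
      forall y, x < y -> s Val y = (y == cgoal)
    & s Val cgoal = 1].

Lemma dpinv_eq x a s s' : s' Val =1 s Val -> s' Choice =1 s Choice -> s' Next =1 s Next ->
  x < N -> dpinv x a s -> dpinv x a s'.
Proof.
move=> EV EC EX x_lt [h1 h2 h3 h4]; split.
- move=> y yx; apply: settled_eq (h1 y yx) => //; exact: ltn_trans x_lt.
- exact: settled_eq h2.
- by move=> y /h3 <-.
- by rewrite EV.
Qed.

Lemma wp_update s o k x : k < na w -> x < N ->
  s Vars vE = k -> s Vars vS = x -> s Vars vD = denprod w ->
  s Vars vAcc = mv x k -> s Vars vCnt = count_mem (hd k) (ds_of x) ->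
  (s Vars vBad == 0) = all (fun y => y <= hd k) (ds_of x) ->
  dpinv x k.+1 s -> wp w G prog_update (fun s' _ => dpinv x k s') s o.
Proof.
move=> k_lt x_lt sE sS sD sA sC sb [h1 [h2a h2b h2c] h3 h4].
have skip : (movable (ds_of x) k -> s Val (mv x k) != 0 ->
              0 < s Val x <= s Val (mv x k) + weight k) -> dpinv x k s.
  move=> ok; split=> //; split=> // l /andP[]; rewrite leq_eqVlt => /orP[/eqP <- _ //|kl l_lt].
  by apply: h2b; rewrite kl.
set c0 := count_mem (hd k) (ds_of x) in sC.
have hin : (hd k \in ds_of x) = (0 < c0) by rewrite -has_pred1 has_count.
have Ec : teval w s (TAdd (TAdd (TV vBad) (TSub (TConst 1) (TV vCnt)))
        (TAdd (TSub (TV vCnt) (Tcap (TV vE))) (TSub (TConst 1) (TGet Val (TV vAcc)))))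
    = s Vars vBad + (1 - c0) + ((c0 - arc_cap w k) + (1 - s Val (mv x k))).
  by rewrite -sA -sC -sE.
apply: wpI; rewrite Ec => Cd.
  apply: wp_skip; apply: skip; rewrite /movable -sb hin -/c0 => /and3P[b0 hc le] V0.
  by move: V0 Cd; lia.
have ok : movable (ds_of x) k by rewrite /movable -sb hin -/c0; lia.
have V0 : s Val (mv x k) != 0 by lia.
have mx := mv_lt base_gt0 tl_lt k_lt x_lt ok.
have xg : x != cgoal.
  apply/eqP => E; move: ok; rewrite E.
  exact/negP/(movable_goal root_lt hd_root k_lt).
pose c := s Val (mv x k) + weight k.
have [_ _ Vm] := h1 _ mx.
(* The successor has a smaller code, so its bound leaves room for one more weight. Bounding values
   by the code avoids any bound on the length of plans. *)
have c_le : c <= 1 + x * big.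
  rewrite /c; have := weight_le k_lt; have : (mv x k).+1 * big <= x * big by rewrite leq_mul2r mx orbT.
  by rewrite mulSn; lia.
have c_lt : c < 2 ^ G.
  apply: leq_ltn_trans value_lt; apply: leq_trans c_le _.
  have : x.+1 * big <= N * big by rewrite leq_mul2r x_lt orbT.
  by rewrite mulSn; lia.
have E1 : teval w s (TAdd (TGet Val (TV vAcc)) (TMul (Tnum (TV vE)) (TDiv (TV vD) (Tden (TV vE))))) = c.
  by rewrite /c -sA /weight -sE -sD.
apply: wp_seq; apply: wpV; rewrite E1 //.
apply: wpI; rewrite /= /set /= sS => Cd2; last first.
  apply: wp_skip; apply: (dpinv_eq (s := s)) => //; apply: skip => _ _; rewrite -/c; lia.
have lt_x y : y < x -> y == x = false by lia.
apply: wp_seq; apply: wpV; first by rewrite /= /set.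
apply: wp_seq; apply: wpV.
  by rewrite /= /set /= sE; apply: leq_G; apply: leq_trans na_le; exact: ltnW.
apply: wpV.
  by rewrite /= /set /= sA; apply: leq_G; apply: leq_trans states_le; apply: ltnW; exact: ltn_trans x_lt.
rewrite /= /set /= sS sE sA; split; rewrite /= ?eqxx.
- move=> y yx; apply: settled_eq (h1 y yx) => //; first exact: ltn_trans x_lt.
  by move=> z zy; rewrite lt_x // (leq_ltn_trans zy).
- split; rewrite /= ?eqxx //.
    by right; right; split; rewrite // lt_x.
  move=> l /andP[kl l_lt] okl; have ml := mv_lt base_gt0 tl_lt l_lt x_lt okl.
  rewrite (lt_x _ ml) => Vl; rewrite /c addn_gt0 lt0n V0 /=.
  move: kl; rewrite leq_eqVlt => /orP[/eqP <- //|kl].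
  (* The value is only overwritten by a smaller one, so the bounds from the arcs tried earlier
     persist. *)
  have /andP[p q] : 0 < s Val x <= s Val (mv x l) + weight l by apply: h2b; rewrite ?kl.
  by rewrite -/c; lia.
- by move=> y xy; rewrite gtn_eqF //; exact: h3.
- by rewrite eq_sym (negbTE xg).
Qed.

Definition all_settled (s : store) :=
  (forall x, x < N -> settled w pos big (s Val) (s Choice) (s Next) x 0) /\ s Val cgoal = 1.

Lemma wp_dp s o : s Val =1 (fun=> 0) -> s Vars vGoal = cgoal -> s Vars vD = denprod w ->
  s Vars vB = B -> s Vars vN = N -> (forall v, v < nv w -> s Pos v = pos v) ->
  wp w G prog_dp (fun s' _ => all_settled s') s o.
Proof.
move=> sV sg sD sB sN sP.
apply: wp_seq; apply: wpV; first exact: leq_G.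
apply: wp_seq; apply: wpV; first exact: leq_G.
set s1 := set _ _ _ _.
have g_lt : cgoal < N := cgoal_lt root_lt.
(* The loop counter runs down while [vS] runs up, which gives the increasing order of states. *)
apply: (wpS (I := fun k s' _ => s' Vars vS = N - k /\
    [/\ forall y, y < N - k -> settled w pos big (s' Val) (s' Choice) (s' Next) y 0,
        forall y, N - k <= y -> s' Val y = (y == cgoal) & s' Val cgoal = 1])) => //.
- by rewrite /= /s1 /set /= sN.
- rewrite /= /s1 /set /= sN subnn sg !eqxx; split=> //; split=> // y _.
  by rewrite sV; case: eqP.
- move=> k s' o' k_lt [fr _] [HS [h1 h2 h3]].
  have nE : teval w s1 (TV vN) = N by rewrite /= /s1 /set.
  rewrite nE in k_lt; set x := N - k.+1 in HS h1 h2 *.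
  have x_lt : x < N by rewrite /x; lia.
  have xE : N - k = x.+1 by rewrite /x; lia.
  apply: wp_seq.
  apply: (wpS (I := fun a s2 _ => dpinv x a s2)) => //.
  + apply: (dpinv_eq (s := s')) => //; split=> //; last by move=> y xy; apply: h2; exact: ltnW.
    split; last by rewrite h2 //; case: eqP; lia.
      by rewrite h2 //; case: eqP => [->|_]; [right; left | left].
    by move=> a; rewrite /= -/(na w); lia.
  + move=> a s2 o2 a_lt [fr2 _] inv; rewrite /= -/(na w) in a_lt.
    have F v : v \in [:: vS; vD; vB] -> s2 Vars v = s' Vars v.
      by rewrite !inE => /or3P[] /eqP ->; rewrite fr2.
    have F' v : v \in [:: vD; vB] -> s2 Vars v = s Vars v.
      by rewrite !inE => /orP[] /eqP ->; rewrite fr2 // /set /= fr.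
    have FS : s2 Vars vS = x by rewrite F.
    have FP v : v < nv w -> s2 Pos v = pos v by move=> v_lt; rewrite fr2 // /set /= fr // /s1 /set /= sP.
    apply: wp_seq; apply: wp_mono.
      apply: (@wp_scan _ _ a x) => //; first by rewrite /set /= F' // sB.
    move=> s3 o3 [fr3 _] [A3 C3 b3].
    apply: wp_update => //; rewrite ?fr3 // ?/set /= ?F' //.
    by apply: (dpinv_eq (s := s2)) => //; move=> y; rewrite fr3.
  + move=> s2 o2 [fr2 _] [g1 g2 g3 g4].
    have E2 : s2 Vars vS = x by rewrite fr2.
    apply: wpV.
      by rewrite /= E2 addn1; apply: leq_G; apply: leq_trans states_le.
    rewrite /= /set /= E2 xE addn1; split=> //; split=> // y.
    rewrite ltnS leq_eqVlt => /orP[/eqP ->|] //.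
    exact: g1.
- by move=> s' o' _ [_ [h1 _ h3]]; split=> // x x_lt; apply: h1; rewrite subn0.
Qed.

Definition arc_out (k : nat) : seq nat := [:: arc_tail w k; arc_head w k].

Lemma wp_out s x0 : all_settled s -> x0 < N -> s Vars vStart = x0 ->
  s Vars vGoal = cgoal -> s Vars vN = N ->
  wp w G prog_out (fun _ o' =>
    (o' = [:: 0] /\ forall ks, ~~ planc w pos x0 ks) \/
    exists2 ks, o' = 1 :: flatten [seq arc_out k | k <- ks] &
      planc w pos x0 ks /\ forall ks', planc w pos x0 ks' -> cost w ks <= cost w ks') s [::].
Proof.
move=> [H Vg] x0_lt s0 sg sN.
have min_val ks : planc w pos x0 ks -> 0 < s Val x0 <= 1 + cost w ks.
  exact: (settled_le base_gt0 tl_lt hd_lt root_lt H Vg).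
apply: wpI; rewrite /= s0 => V0; last first.
  apply: wpW; left; split=> // ks; apply/negP => /min_val; lia.
apply: wp_seq; apply: wpW; apply: wp_seq; apply: wpV.
  by rewrite /= s0; apply/leq_G; apply: leq_trans states_le; exact: ltnW.
set s1 := set _ _ _ _.
(* Each traced move lowers the code, so the current state is below the number [j] of remaining
   rounds until the goal is reached; with no round left it must be the goal. *)
apply: (wpS (I := fun j s' o' => exists x ks, [/\ s' Vars vS = x, x < N,
    o' = 1 :: flatten [seq arc_out k | k <- ks], x = cgoal \/ x < j &
    [/\ s Val x != 0, s Val x0 = s Val x + cost w ks &
      forall ks', planc w pos x ks' -> planc w pos x0 (ks ++ ks')]])) => //.
- by rewrite /= /s1 /set /= sN.
- exists x0, [::]; split=> //; first by right; rewrite /= /s1 /set /= sN.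
  by split=> //; rewrite /cost big_nil addn0.
- move=> j s' o' _ [fr _] [x [ks [xE x_lt oE xj [Vx VE PE]]]].
  have EV : s' Val =1 s Val by move=> y; rewrite fr.
  have EC : s' Choice =1 s Choice by move=> y; rewrite fr.
  have EX : s' Next =1 s Next by move=> y; rewrite fr.
  have Eg : s' Vars vGoal = cgoal by rewrite fr // /s1 /set.
  apply: wpI; rewrite /= /set /= xE Eg => Cd; last first.
    have xg : x = cgoal by lia.
    by apply: wp_skip; exists x, ks; split=> //; left.
  have xg : x <> cgoal by lia.
  have x_j : x < j.+1 by case: xj.
  have [[h|[//|[C_lt ok XE VX VxE]]] _ _] := H x x_lt; first by rewrite h in Vx.
  apply: wp_seq; apply: wpW; apply: wp_seq; apply: wpW; apply: wpV.
    rewrite /= /set /= xE EX XE; apply/leq_G; apply: leq_trans states_le; apply: ltnW.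
    exact: mv_lt_states.
  have m_lt := mv_lt base_gt0 tl_lt C_lt x_lt ok.
  rewrite /= /set /= xE EX EC; exists (s Next x), (rcons ks (s Choice x)); split=> //.
  + by rewrite XE; exact: mv_lt_states.
  + by rewrite oE map_rcons flatten_rcons -!cats1 /= -catA.
  + by right; rewrite XE; apply: leq_trans m_lt _.
  split=> //.
    by rewrite /cost -cats1 big_cat big_seq1 /= -/(cost w ks) VE VxE addnAC addnA.
  by move=> ks' p'; rewrite cat_rcons; apply: PE; rewrite /= C_lt ok -XE.
- move=> s' o' _ [x [ks [_ _ -> [xg|//] [Vx VE PE]]]]; right; exists ks => //.
  have pk : planc w pos x0 ks by rewrite -[ks]cats0; apply: PE; rewrite xg /= eqxx.
  split=> // ks' /min_val /andP[_]; rewrite VE xg Vg; lia.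
Qed.

End DP.

(** * Correctness of the whole program in terms of plans *)

Definition optimal_plan_output (w : seq nat) (pos : nat -> nat) (out : seq nat) :=
  (out = [:: 0] /\ forall ks, ~~ plan w pos (start w pos) ks) \/
  exists2 ks, out = 1 :: flatten [seq arc_out w k | k <- ks] &
    plan w pos (start w pos) ks /\
    forall ks', plan w pos (start w pos) ks' -> cost w ks <= cost w ks'.

(** There are two digit bounds. [L] serves for the input words and [denprod], so that a weight is at
    most [2 ^ (L + L)]; [G] serves for everything stored, since [nstates w * 2 ^ (L + L)] is below
    [2 ^ (nstates w + (L + L))]. *)
Lemma steiner_prog_correct (w : seq nat) (G L : nat) (h : nat -> nat) :
  (forall i, nth 0 w i < 2 ^ L) -> size w < 2 ^ L -> 0 < L ->
  root_id w < nv w ->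
  (forall k, k < na w -> arc_tail w k < nv w /\ arc_head w k < nv w) ->
  (forall k, k < na w -> h (arc_tail w k) < h (arc_head w k)) ->
  (forall v, v < nv w -> h v < nv w) ->
  (forall k, k < na w -> arc_head w k != root_id w) ->
  (forall j, j < nt w -> term_at w j < nv w) ->
  (forall k, k < na w -> 0 < arc_den w k) -> denprod w < 2 ^ L ->
  0 < nt w -> nt w <= G -> na w <= G -> nv w * (nv w * nv w) <= G ->
  nstates w + (L + L) <= G ->
  exists t out, [/\ runs (compile steiner_prog) w t out, t <= ptime steiner_prog G &
    exists2 pos, numbering w pos & optimal_plan_output w pos out].
Proof.
move=> w_ltL size_wL L_gt0 root_lt arc_lt h_arc h_lt head_root term_lt.
move=> den_gt0 D_lt nt_gt0 nt_le na_le nv3_le N_le.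
have LG : 2 ^ L <= 2 ^ G by rewrite leq_exp2l //; lia.
have w_lt i : nth 0 w i < 2 ^ G by apply: leq_trans LG.
have size_w : size w < 2 ^ G by apply: leq_trans LG.
have G_gt0 : 0 < G by lia.
have nv_gt0 : 0 < nv w by exact: leq_ltn_trans root_lt.
have base_gt0 : 0 < base w by rewrite muln_gt0 nv_gt0.
have big_gt0 : 0 < 2 ^ (L + L) by rewrite expn_gt0.
have weight_le k : k < na w -> weight w k <= 2 ^ (L + L).
  move=> k_lt; rewrite expnD; apply: leq_mul; first exact: ltnW (w_ltL _).
  by apply: leq_trans (leq_div _ _) (ltnW D_lt).
have value_lt : nstates w * 2 ^ (L + L) < 2 ^ G.
  apply: (@leq_trans (2 ^ (nstates w + (L + L)))); last by rewrite leq_exp2l.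
  by rewrite [2 ^ (nstates w + _)]expnD ltn_pmul2r // ltn_expl.
pose zero : store := fun _ _ => 0.
have : wp w G steiner_prog
    (fun _ out => exists2 pos, numbering w pos & optimal_plan_output w pos out) zero [::].
  apply: wp_seq; apply: wp_mono.
    by apply: (wp_den w_lt size_w G_gt0 na_le den_gt0); apply: leq_trans LG.
  move=> s1 o1 [fr1 fo1] D1; apply: wp_seq; apply: wp_mono.
    exact: (wp_pos w_lt size_w G_gt0 na_le root_lt arc_lt h_arc h_lt nv3_le).
  move=> s2 o2 [fr2 fo2] numb; set pos := s2 Pos in numb.
  have [posP inc] := numb.
  have pos_lt v : v < nv w -> pos v < nv w * nv w by move=> /posP[].
  have tl_lt k : k < na w -> tl w pos k < hd w pos k by move=> k_lt; apply: inc.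
  have hd_lt k : k < na w -> hd w pos k < base w by move=> k_lt; apply: pos_lt; case: (arc_lt k k_lt).
  have rb : pos (root_id w) < base w by exact: pos_lt.
  have hr k : k < na w -> hd w pos k != pos (root_id w).
    move=> k_lt; apply: contra (head_root k k_lt) => /eqP E.
    have [hE _] := posP _ (proj2 (arc_lt k k_lt)); have [rE _] := posP _ root_lt.
    by rewrite -hE -[X in _ == X]rE -E.
  have s_le : base w ^ nt w <= G by apply: leq_trans N_le; rewrite leq_addr.
  have start_lt : all (fun x => x < base w) (start w pos).
    apply/allP => x /mapP[j]; rewrite mem_iota => /andP[_ j_lt] ->.
    by apply: pos_lt; apply: term_lt.
  have start_size : size (start w pos) = nt w by rewrite size_map size_iota.
  apply: wp_seq; apply: wp_mono.
    exact: (wp_init w_lt size_w G_gt0 na_le root_lt nv3_le pos_lt term_lt nt_le s_le).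
  move=> s3 o3 [fr3 fo3] [B3 N3 S3 G3].
  have P3 v : v < nv w -> s3 Pos v = pos v by move=> _; rewrite fr3.
  apply: wp_seq; apply: wp_mono.
    apply: (wp_dp w_lt size_w G_gt0 base_gt0 arc_lt tl_lt hd_lt rb hr nt_gt0 nt_le na_le
      s_le big_gt0 weight_le value_lt) => //.
      by move=> x; rewrite fr3 // fr2 // fr1.
    by rewrite fr3 // fr2.
  move=> s4 o4 [fr4 fo4] settled4; have -> : o4 = [::] by rewrite fo4 // fo3 // fo2 // fo1.
  apply: wp_mono.
    apply: (wp_out w_lt size_w G_gt0 base_gt0 tl_lt hd_lt rb nt_gt0 nt_le na_le s_le big_gt0 value_lt
      settled4 (x0 := code (base w) (start w pos))).
    - by have := code_lt start_lt; rewrite start_size.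
    - by rewrite fr4.
    - by rewrite fr4.
    - by rewrite fr4.
  move=> s5 o5 _ H; exists pos => //.
  have E ks : planc w pos (code (base w) (start w pos)) ks = plan w pos (start w pos) ks.
    exact: planc_code.
  case: H => [[oE H]|[ks oE [p H]]]; [left|right].
    by split=> // ks; rewrite -E.
  exists ks => //; rewrite -E; split=> // ks'; rewrite -E; exact: H.
move=> /(_ (fun=> 0)) [||t [m [s [out [ex t_le _ _ [_ H]]]]]] //.
  by move=> a; rewrite expn_gt0.
by exists t, out; split=> //; exists m.
Qed.

(** * Token plans and trees *)

Section Rank.

Variables (V : finType) (E : {set V * V}).
Hypothesis acyclicE : acyclic E.

(** [acyclic] only speaks of circuits without repeated vertices, hence the shortening of the
    path. *)
Lemma acyclic_connect u v : (u, v) \in E -> connect (arc_rel E) v u -> False.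
Proof.
move=> uvE /connectP[p p_path uE]; case/shortenP: p_path uE => q q_path q_uniq _ uE.
suff: v :: q = [::] by [].
by apply: acyclicE => //=; rewrite rcons_path q_path /= -uE.
Qed.

(** The number of proper ancestors will instantiate the height [h], which exists only in the proof:
    the program never computes it. Excluding [v] itself keeps the count below the number of
    vertices. *)
Definition ancestors (v : V) : {set V} := [set x | (x != v) && connect (arc_rel E) x v].

Lemma ancestors_lt v : #|ancestors v| < #|V|.
Proof.
rewrite -cardsT; apply: proper_card; apply/properP; split; first exact: subsetT.
by exists v; rewrite ?inE // eqxx.
Qed.

Lemma ancestors_arc u v : (u, v) \in E -> #|ancestors u| < #|ancestors v|.
Proof.
move=> uvE; apply: proper_card; apply/properP; split.
  apply/subsetP => x; rewrite !inE => /andP[xu xc]; apply/andP; split.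
    by apply/eqP => xv; subst x; exact: acyclic_connect uvE xc.
  by apply: connect_trans xc _; exact: connect1.
exists u; rewrite !inE ?eqxx //= connect1 // andbT.
by apply/eqP => uv; subst v; exact: acyclic_connect uvE (connect0 _ _).
Qed.

End Rank.

(** * Token plans on the graph and the out-trees they trace *)

Section TokenPlans.

Variables (V : finType) (E : {set V * V}) (r : V) (pos : V -> nat) (cap : V * V -> nat).
Hypothesis pos_inj : injective pos.
Hypothesis pos_arc : forall e, e \in E -> pos e.1 < pos e.2.
Hypothesis pos_root : forall v, pos r <= pos v.

Definition vmovable (p : seq V) (e : V * V) :=
  [&& all (fun x => pos x <= pos e.2) p, e.2 \in p & count_mem e.2 p <= cap e].

Definition vmove (p : seq V) (e : V * V) := [seq if x == e.2 then e.1 else x | x <- p].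

Fixpoint vplan (p : seq V) (fs : seq (V * V)) : bool :=
  if fs is e :: fs' then [&& e \in E, vmovable p e & vplan (vmove p e) fs']
  else p == nseq (size p) r.

Lemma vplan_head_le p fs c : vplan p fs -> (forall x, x \in p -> pos x <= c) ->
  forall e, e \in fs -> pos e.2 <= c.
Proof.
elim: fs p => //= e fs IH p /and3P[eE /and3P[_ ep _] pl] le e'.
rewrite inE => /orP[/eqP -> |]; first exact: le.
apply: IH pl _ e' => x /mapP[y yp ->]; case: eqP => _; last exact: le.
by apply: leq_trans (ltnW (pos_arc eE)) (le _ ep).
Qed.

(** After the move every token lies strictly before [e.2]: none lay beyond it, and by injectivity of
    [pos] those not on it were already before it. Strictly decreasing heads give distinct arcs and
    at most one arc into each vertex. *)
Lemma vplan_head_lt p e fs : vplan p (e :: fs) -> forall e', e' \in fs -> pos e'.2 < pos e.2.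
Proof.
move=> /= /and3P[eE /and3P[/allP al ep _] pl] e' e'_in.
have p0 : 0 < pos e.2 by apply: leq_ltn_trans (pos_arc eE).
rewrite -(prednK p0) ltnS; apply: vplan_head_le pl _ _ e'_in => x /mapP[y yp ->].
rewrite -ltnS prednK //; case: eqP => [_|ne]; first exact: pos_arc.
by rewrite ltn_neqAle al // andbT; apply/eqP => /pos_inj.
Qed.

Lemma vplan_uniq p fs : vplan p fs -> uniq fs.
Proof.
elim: fs p => //= e fs IH p pl; have lt := @vplan_head_lt p e fs pl.
case/and3P: pl => _ _ /IH ->; rewrite andbT; apply/negP => /lt; by rewrite ltnn.
Qed.

Lemma vplan_sub p fs : vplan p fs -> {subset fs <= E}.
Proof.
elim: fs p => //= e fs IH p /and3P[eE _ /IH sub] e'.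
by rewrite inE => /orP[/eqP ->|/sub].
Qed.

Lemma vplan_in_arc_inj p fs e e' : vplan p fs -> e \in fs -> e' \in fs -> e.2 = e'.2 -> e = e'.
Proof.
elim: fs p => //= f fs IH p pl; have lt := @vplan_head_lt p f fs pl.
case/and3P: pl => _ _ /IH{}IH.
rewrite !inE => /orP[/eqP->|e_in] /orP[/eqP->|e'_in] E2 //; last exact: IH.
- by have := lt _ e'_in; rewrite E2 ltnn.
- by have := lt _ e_in; rewrite E2 ltnn.
Qed.

Definition arcs_of (fs : seq (V * V)) : {set V * V} := [set e in fs].

Lemma connect_cons e fs x y :
  connect (arc_rel (arcs_of fs)) x y -> connect (arc_rel (arcs_of (e :: fs))) x y.
Proof.
apply: connect_sub => a b ab; apply: connect1; move: ab.
by rewrite /arc_rel !inE => ->; rewrite orbT.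
Qed.

Lemma vplan_connect p fs : vplan p fs ->
  (forall x, x \in p -> connect (arc_rel (arcs_of fs)) r x) /\
  (forall e, e \in fs -> connect (arc_rel (arcs_of fs)) r e.1).
Proof.
elim: fs p => /= [|e fs IH] p.
  by move=> /eqP E0; split=> // x; rewrite E0 => /nseqP[-> _]; exact: connect0.
case/and3P => eE /and3P[_ ep _] /IH[H1 H2].
have He : connect (arc_rel (arcs_of (e :: fs))) r e.1.
  by apply/connect_cons/H1/mapP; exists e.2; rewrite ?eqxx.
split=> [x xp|e']; last by rewrite inE => /orP[/eqP-> //|/H2/connect_cons].
have [->|ne] := eqVneq x e.2.
  apply: connect_trans He _; apply: connect1.
  by rewrite /arc_rel !inE -surjective_pairing eqxx.
by apply/connect_cons/H1/mapP; exists x; rewrite // (negbTE ne).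
Qed.

(** Nothing leaves [e.2], so a path that uses [e] has to end there. *)
Lemma path_avoid e fs a q : (forall z, (e.2, z) \notin arcs_of (e :: fs)) ->
  path (arc_rel (arcs_of (e :: fs))) a q -> last a q != e.2 ->
  path (arc_rel (arcs_of fs)) a q.
Proof.
move=> noout; elim: q a => //= z q IH a /andP[az zq] lst.
rewrite IH // andbT; move: az; rewrite /arc_rel !inE => /orP[/eqP azE|//].
have zE : z = e.2 by rewrite -azE.
case: q zq lst {IH} => [|z' q] /=; first by rewrite zE eqxx.
by rewrite zE /arc_rel (negbTE (noout z')).
Qed.

(* Along a plan, the tokens moved together over [e] are the ones lying below [e]. *)
Lemma vplan_load p fs : vplan p fs ->
  forall e, e \in fs -> count (connect (arc_rel (arcs_of fs)) e.2) p <= cap e.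
Proof.
elim: fs p => //= e0 fs IH p pl; have lt := @vplan_head_lt p e0 fs pl.
have sub := @vplan_sub p (e0 :: fs) pl.
case/and3P: pl => e0E /and3P[al ep le] pl.
(* An arc leaving [e0.2] would be a later one, whose head comes after [e0.2], whereas later heads
   come before it. *)
have noout z : (e0.2, z) \notin arcs_of (e0 :: fs).
  rewrite !inE; apply/negP => /orP[/eqP zE|/[dup] zin /lt /=].
    by have := pos_arc e0E; rewrite -(congr1 fst zE) ltnn.
  apply/negP; rewrite -leqNgt ltnW //; apply: (pos_arc (e := (e0.2, z))).
  by apply: sub; rewrite inE zin orbT.
have noout_connect x : connect (arc_rel (arcs_of (e0 :: fs))) e0.2 x -> x = e0.2.
  by case/connectP => [[|z q]] //= /andP[]; rewrite /arc_rel (negbTE (noout z)).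
move=> e; rewrite inE; have [-> _|ne /= e_in] := eqVneq e e0.
  apply: leq_trans le; apply: sub_count => x /= /noout_connect ->; exact: eqxx.
apply: leq_trans (IH _ pl e e_in); rewrite count_map; apply: sub_count => x /= /connectP[q q_path xE].
have [xe|xne] := eqVneq x e0.2; last first.
  by apply/connectP; exists q => //; apply: path_avoid q_path _; rewrite // -xE.
have e2ne : e.2 != e0.2 by apply/eqP => E2; have := lt _ e_in; rewrite E2 ltnn.
(* A token on [e0.2] lies below [e] along a path whose last arc can only be [e0]. Dropping that arc
   leads to [e0.1], where the token stands after the move. *)
case/lastP: q q_path xE => [|q z] /=; first by move=> _ xE; rewrite -xE xe eqxx in e2ne.
rewrite rcons_path last_rcons => /andP[q_path lz] xz.
have lE : last e.2 q = e0.1.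
  move: lz; rewrite -xz xe /arc_rel !inE => /orP[/eqP E0|/lt /=]; last by rewrite ltnn.
  by have := congr1 fst E0.
apply/connectP; exists q; rewrite ?lE //.
apply: path_avoid q_path _ => //; rewrite lE; apply/eqP => E12.
by have := pos_arc e0E; rewrite E12 ltnn.
Qed.

(** Two walks from the root to the same vertex agree when read backwards, because each vertex has at
    most one entering arc and the root has none. *)
Lemma vplan_out_tree p fs : vplan p fs -> (forall e, e \in E -> e.2 != r) ->
  out_tree r (subtree (arcs_of fs) r) (arcs_of fs).
Proof.
move=> pl noroot; have [_ Htl] := vplan_connect pl; split.
- by rewrite inE connect0.
- move=> u v; rewrite !inE => uv; have ru := Htl _ uv; split=> //.
  by apply: connect_trans ru _; apply: connect1; rewrite /arc_rel inE.
move=> v; rewrite inE => /connectP[q q_path vE]; exists q; split=> // q' [].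
have noin x : ~~ arc_rel (arcs_of fs) x r.
  by rewrite /arc_rel inE; apply/negP => /(vplan_sub pl)/noroot; rewrite eqxx.
move=> q'_path; rewrite {}vE.
elim/last_ind: q q' q_path q'_path => [|q a IH] q'; elim/last_ind: q' => [|q' a' _] //=.
- by rewrite rcons_path last_rcons => _ /andP[_ +] a'r; rewrite a'r (negbTE (noin _)).
- by rewrite rcons_path last_rcons => /andP[_ +] _ ar; rewrite -ar (negbTE (noin _)).
rewrite !rcons_path !last_rcons => /andP[q_path qa] /andP[q'_path qa'] aE; subst a'.
rewrite (IH q') //; move: qa qa'; rewrite /arc_rel !inE => h1 h2.
by have := congr1 fst (vplan_in_arc_inj pl h1 h2 erefl).
Qed.

(** For the induction the tokens may stand anywhere in the tree, each above its own terminal. The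
    tokens on [u] then belong to terminals below [u], so the capacity of the tree arc into [u]
    admits them all. The sum of positions decreases. *)
Lemma tree_vplan (W : {set V}) (F : {set V * V}) (ts p : seq V) :
  F \subset E -> out_tree r W F ->
  (forall e, e \in F -> count (connect (arc_rel F) e.2) ts <= cap e) ->
  size p = size ts -> all (mem W) p ->
  all (fun xt => connect (arc_rel F) xt.1 xt.2) (zip p ts) ->
  exists2 fs, vplan p fs & {subset fs <= F}.
Proof.
move=> FE [rW FW pathW] load.
have [c] := ubnP (sumn [seq pos x | x <- p]); elim: c p => // c IH p.
rewrite ltnS => p_le sz pW pts.
have [all_r|/allPn[x xp xr]] := boolP (all (pred1 r) p).
  by exists [::] => //=; apply/eqP/all_pred1P.
case: (@arg_maxnP _ x (mem p) pos xp) => u up umax.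
(* The root has the least position: if the last occupied vertex were the root, every token would be
   on it. *)
have ur : u != r.
  apply/eqP => E0; have := umax x xp; rewrite E0 /geq /= => le.
  by move: xr; rewrite /= -(inj_eq pos_inj) eqn_leq le pos_root.
have [q [[q_path uE] _]] := pathW u (allP pW _ up).
case/lastP: q q_path uE => [|q z] /=; first by move=> _ E0; rewrite E0 eqxx in ur.
rewrite rcons_path last_rcons => /andP[_ +] zu; rewrite zu => vu.
set v := last r q in vu; have vuF : (v, u) \in F by [].
have vuE : (v, u) \in E := subsetP FE _ vuF.
have vu_lt : pos v < pos u := pos_arc vuE.
have cnt : count_mem u p <= count (connect (arc_rel F) u) ts.
  elim: p ts sz pts {IH p_le pW xp up umax load} => [|y p IHp] [|t ts] //= [sz] /andP[yt pts].
  by apply: leq_add (IHp _ sz pts); case: eqP => // <-; rewrite yt.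
have [||||fs pl sub] := IH (vmove p (v, u)).
- apply: leq_trans p_le; rewrite /vmove -map_comp.
  have le y : pos (if y == u then v else y) <= pos y by case: eqP => // ->; exact: ltnW.
  elim: p up {IH sz pW pts xp umax cnt} => //= y p IHp; rewrite inE.
  have le_all : sumn [seq (pos \o (fun x0 => if x0 == u then v else x0)) i | i <- p]
      <= sumn [seq pos i | i <- p].
    by elim: p {IHp} => //= y' p IHp; exact: leq_add.
  have [<- _|_ /IHp lt] := eqVneq u y; first by rewrite -addSn leq_add.
  by rewrite -addnS leq_add // le.
- by rewrite size_map.
- apply/allP => _ /mapP[y yp ->]; case: eqP => _; last exact: (allP pW).
  by case: (FW _ _ vuF).
- elim: p ts sz pts {IH p_le pW xp up umax load cnt} => [|y p IHp] [|t ts] //= [sz] /andP[yt pts].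
  rewrite IHp // andbT; case: eqP => // yu; subst y.
  by apply: connect_trans yt; exact: connect1.
exists ((v, u) :: fs) => /=.
  rewrite vuE pl andbT /=; apply/and3P; split; [by apply/allP => y /umax | by [] |].
  exact: leq_trans cnt (load _ vuF).
by move=> e; rewrite inE => /orP[/eqP ->|/sub].
Qed.

End TokenPlans.

(** * Encoded instances *)

Lemma nth_flatten_const (T : Type) (g : T -> seq nat) c x0 (es : seq T) k f :
  (forall e, size (g e) = c) -> k < size es -> f < c ->
  nth 0 (flatten [seq g e | e <- es]) (f + c * k) = nth 0 (g (nth x0 es k)) f.
Proof.
move=> sz; elim: es k => //= e es IH [|k] k_lt f_lt; rewrite nth_cat sz.
  by rewrite muln0 addn0 f_lt.
by rewrite mulnS addnCA ltnNge leq_addr /= addKn IH.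
Qed.

Lemma mem_bitsize x w : x \in w -> bitlen x <= bitsize w.
Proof. by move=> xw; rewrite /bitsize (big_rem x xw) leq_addr. Qed.

Lemma size_bitsize w : size w <= bitsize w.
Proof. by rewrite /bitsize -sum1_size leq_sum. Qed.

Lemma nth_lt_bitsize w i : nth 0 w i < 2 ^ bitsize w.
Proof.
have [i_lt|?] := ltnP i (size w); last by rewrite nth_default // expn_gt0.
apply: leq_trans (bitlen_gt _) _; rewrite leq_exp2l //.
exact/mem_bitsize/mem_nth.
Qed.

(** Nonemptiness matters: the empty product 1 is not below [2 ^ 0]. *)
Lemma prod_lt_bitsize (T : Type) (es : seq T) (f : T -> nat) :
  0 < size es -> \prod_(e <- es) f e < 2 ^ (\sum_(e <- es) bitlen (f e)).
Proof.
elim: es => //= e [|e' es] IH _; first by rewrite !big_seq1 bitlen_gt.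
rewrite [X in X < _]big_cons [X in _ < _ ^ X]big_cons expnD.
by apply: ltn_mul; [exact: bitlen_gt | exact: IH].
Qed.

Section Encoded.

Variables (I : instance) (ts : seq 'I_(nvert I)) (es : seq ('I_(nvert I) * 'I_(nvert I))).
Hypothesis validI : valid I.
Hypothesis acyclicI : acyclic (arcs I).
Hypothesis perm_ts : perm_eq ts (enum (terminals I)).
Hypothesis perm_es : perm_eq es (enum (arcs I)).

Local Notation r := (rootv I).
Let w := [:: nvert I; size ts; size es; val r]
           ++ [seq val t | t <- ts] ++ flatten [seq arc_code e | e <- es].
Let arc k := nth (r, r) es k.

Lemma nth_tail4 i :
  nth 0 w (4 + i) = nth 0 ([seq val t | t <- ts] ++ flatten [seq arc_code e | e <- es]) i.
Proof. by []. Qed.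

Lemma enc_field f k : k < size es -> f < 5 -> field w f k = nth 0 (arc_code (arc k)) f.
Proof.
move=> k_lt f_lt; rewrite /field; change (nth 0 w 1) with (size ts).
rewrite -!addnA (nth_tail4 (f + _)) nth_cat size_map.
rewrite addnCA ltnNge leq_addr /= addKn.
exact: nth_flatten_const.
Qed.

Lemma enc_tail k : k < size es -> arc_tail w k = val (arc k).1.
Proof. by move=> k_lt; rewrite /arc_tail enc_field. Qed.
Lemma enc_head k : k < size es -> arc_head w k = val (arc k).2.
Proof. by move=> k_lt; rewrite /arc_head enc_field. Qed.
Lemma enc_num k : k < size es -> arc_num w k = `|numq (len (arc k))|%N.
Proof. by move=> k_lt; rewrite /arc_num enc_field. Qed.
Lemma enc_den k : k < size es -> arc_den w k = `|denq (len (arc k))|%N.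
Proof. by move=> k_lt; rewrite /arc_den enc_field. Qed.
Lemma enc_cap k : k < size es -> arc_cap w k = cap (arc k).
Proof. by move=> k_lt; rewrite /arc_cap enc_field. Qed.

Lemma enc_term j : j < size ts -> term_at w j = val (nth r ts j).
Proof.
move=> j_lt; rewrite /term_at nth_tail4 nth_cat size_map j_lt.
by rewrite (nth_map r).
Qed.

Lemma mem_es e : (e \in es) = (e \in arcs I).
Proof. by rewrite (perm_mem perm_es) mem_enum. Qed.

Lemma arc_in k : k < size es -> arc k \in arcs I.
Proof. by move=> k_lt; rewrite -mem_es mem_nth. Qed.

(** The root reaches every vertex, so an arc into it would close a circuit. *)
Lemma head_neq_root e : e \in arcs I -> e.2 != r.
Proof.
case: validI => _ _ _ conn _; case: e => u v uvE /=; apply/eqP => vr; subst v.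
exact: (acyclic_connect acyclicI uvE (conn u)).
Qed.

(** The number of vertices is written in binary, so a priori it could be exponential in the input
    size. Reachability from the root gives every other vertex an entering arc, and the arcs are
    listed one by one. *)
Lemma nvert_le : nvert I <= (size es).+1.
Proof.
case: validI => _ _ _ conn _.
have sub : [set~ r] \subset snd @: arcs I.
  apply/subsetP => v; rewrite !inE => vr; have /connectP[q] := conn v.
  case/lastP: q => [|q z] /=; first by move=> _ vE; rewrite vE eqxx in vr.
  rewrite rcons_path last_rcons => /andP[_ az] vE; subst z.
  by apply/imsetP; exists (last r q, v).
have := leq_trans (subset_leq_card sub) (leq_imset_card _ _).
rewrite cardsC1 card_ord.
have -> : #|arcs I| = size es by rewrite cardE (perm_size perm_es).
lia.
Qed.

Lemma denprodE : denprod w = \prod_(e <- es) `|denq (len e)|%N.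
Proof.
rewrite /denprod (big_nth (r, r)) big_seq_cond [RHS]big_seq_cond.
by apply: eq_bigr => k; rewrite andbT mem_index_iota => /andP[_ k_lt]; exact: enc_den.
Qed.

Lemma bitsize_den : \sum_(e <- es) bitlen `|denq (len e)|%N <= bitsize w.
Proof.
rewrite /w /bitsize !big_cat /= -[leqLHS]add0n leq_add // -[leqLHS]add0n leq_add //.
rewrite big_flatten big_map; apply: leq_sum => e _.
by apply: (@mem_bitsize _ (arc_code e)); rewrite !inE eqxx !orbT.
Qed.

(** * Translation between plans on the input word and Steiner trees *)

Section Numbered.

Variable num_of : nat -> nat.
Hypothesis numb : numbering w num_of.

Let pos (v : 'I_(nvert I)) := num_of (val v).

Lemma pos_inj : injective pos.
Proof.
have [H _] := numb; move=> u v E; apply: val_inj.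
have [Hu _] := H _ (ltn_ord u); have [Hv _] := H _ (ltn_ord v).
exact: etrans (esym Hu) (etrans (congr1 (fun x => x %% _) E) Hv).
Qed.

Lemma pos_arc e : e \in arcs I -> pos e.1 < pos e.2.
Proof.
have [_ H] := numb; rewrite -mem_es => e_in; have i_lt := e_in; rewrite -index_mem in i_lt.
by have := H _ i_lt; rewrite enc_tail // enc_head // /arc nth_index.
Qed.

Lemma pos_root v : pos r <= pos v.
Proof.
case: validI => _ _ _ /(_ v) /connectP[q q_path ->] _.
elim: q r q_path => //= z q IH a /andP[az /IH]; apply: leq_trans.
exact: ltnW (pos_arc az).
Qed.

Local Notation vplan := (vplan (arcs I) r pos (@cap I)).

Lemma plan_vplan p ks : size p = size ts -> (forall k, k \in ks -> k < size es) ->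
  plan w num_of [seq pos x | x <- p] ks = vplan p [seq arc k | k <- ks].
Proof.
elim: ks p => [|k ks IH] p sz ks_lt.
  rewrite /= /goal; change (nt w) with (size ts); rewrite sz.
  change (num_of (root_id w)) with (pos r).
  by rewrite -map_nseq (inj_eq (inj_map pos_inj)).
have k_lt : k < size es by apply: ks_lt; rewrite mem_head.
have ks_lt' l : l \in ks -> l < size es by move=> l_in; apply: ks_lt; rewrite inE l_in orbT.
have hdE : hd w num_of k = pos (arc k).2 by rewrite /hd enc_head.
have tlE : tl w num_of k = pos (arc k).1 by rewrite /tl enc_tail.
rewrite /= arc_in //; change (na w) with (size es); rewrite k_lt /=.
have -> : movable w num_of [seq pos x | x <- p] k = vmovable pos (@cap I) p (arc k).
  rewrite /movable /vmovable hdE enc_cap // all_map (mem_map pos_inj) count_map.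
  by congr [&& _, _ & _ <= _]; apply: eq_count => x /=; rewrite (inj_eq pos_inj).
have -> : move w num_of [seq pos x | x <- p] k = [seq pos x | x <- vmove p (arc k)].
  rewrite /move /replace /vmove -!map_comp; apply: eq_map => x /=.
  by rewrite hdE tlE (inj_eq pos_inj); case: ifP.
by rewrite IH // size_map.
Qed.

Lemma startE : start w num_of = [seq pos x | x <- ts].
Proof.
rewrite /start; change (nt w) with (size ts).
rewrite -[in RHS](mkseq_nth r ts) /mkseq -map_comp; apply/eq_in_map => j.
by rewrite mem_iota => /andP[_ j_lt]; rewrite /= enc_term.
Qed.

Lemma plan_lt p ks : plan w num_of p ks -> forall k, k \in ks -> k < size es.
Proof.
elim: ks p => //= k ks IH p /and3P[k_lt _ /IH H] l.
by rewrite inE => /orP[/eqP ->|/H].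
Qed.

(** Every denominator divides [denprod], so the division in [weight] is exact; nonnegative lengths
    make the encoded absolute value the numerator. Comparing integer costs thus compares lengths. *)
Lemma costE ks : (forall k, k \in ks -> k < size es) ->
  ((cost w ks)%:R = (denprod w)%:R * \sum_(e <- [seq arc k | k <- ks]) len e)%R.
Proof.
case: validI => _ _ _ _ Hlen ks_lt.
rewrite /cost natr_sum big_map mulr_sumr big_seq_cond [RHS]big_seq_cond.
apply: eq_bigr => k; rewrite andbT => /ks_lt k_lt.
have [len_ge0 _] := Hlen _ (arc_in k_lt).
have k_in : k \in index_iota 0 (na w) by rewrite mem_index_iota.
have dvd : arc_den w k %| denprod w.
  by rewrite /denprod (bigD1_seq k k_in) ?iota_uniq //= dvdn_mulr.
rewrite /weight natrM -[X in (_ = X%:R * _)%R](divnK dvd) natrM enc_num // enc_den //.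
set x := len (arc k); set D := (_ %/ _)%N.
have d0 : ((`|denq x|%N)%:R : rat) != 0%R by rewrite pnatr_eq0 absz_eq0 denq_eq0.
have xE : x = ((`|numq x|%N)%:R / (`|denq x|%N)%:R)%R.
  by rewrite !natr_absz ger0_norm ?numq_ge0 // normr_denq divq_num_den.
by rewrite [X in _ = (_ * X)%R]xE mulrACA mulfV // mulr1 mulrC.
Qed.

Lemma count_subtree F v :
  count (connect (arc_rel F) v) ts = #|terminals I :&: subtree F v|.
Proof.
have ts_uniq : uniq ts by rewrite (perm_uniq perm_ts) enum_uniq.
rewrite -size_filter -(card_uniqP (filter_uniq _ ts_uniq)); apply: eq_card => t.
by rewrite !inE mem_filter (perm_mem perm_ts) mem_enum andbC.
Qed.

Lemma vplan_feasible fs : vplan ts fs ->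
  feasible I (subtree (arcs_of fs) r) (arcs_of fs) /\
  total_length I (arcs_of fs) = (\sum_(e <- fs) len e)%R.
Proof.
move=> pl; have fs_uniq := vplan_uniq pos_inj pos_arc pl.
have [conn _] := vplan_connect pl; split; last first.
  by rewrite /total_length big_uniq //=; apply: eq_bigl => e; rewrite inE.
split.
- by apply/subsetP => e; rewrite inE => /(vplan_sub pl).
- exact: (vplan_out_tree pos_inj pos_arc pl head_neq_root).
- apply/subsetP => t t_in; rewrite inE; apply: conn.
  by rewrite (perm_mem perm_ts) mem_enum.
- move=> e; rewrite inE => e_in; rewrite -count_subtree.
  exact: (vplan_load pos_inj pos_arc pl e_in).
Qed.

(** Only an inequality: the plan uses arcs of [F] but may omit branches without terminals, which is
    harmless because lengths are nonnegative. *)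
Lemma feasible_vplan W F : feasible I W F ->
  exists2 fs, vplan ts fs & (\sum_(e <- fs) len e <= total_length I F)%R.
Proof.
case=> FE tree TW load.
have load' e : e \in F -> count (connect (arc_rel F) e.2) ts <= cap e.
  by move=> e_in; rewrite count_subtree; exact: load.
have tsW : all (mem W) ts.
  by apply/allP => t; rewrite (perm_mem perm_ts) mem_enum => /(subsetP TW).
have refl_ts : all (fun xt => connect (arc_rel F) xt.1 xt.2) (zip ts ts).
  by elim: (ts) => //= t l ->; rewrite connect0.
have [fs pl sub] := tree_vplan pos_inj pos_arc pos_root FE tree load' erefl tsW refl_ts.
exists fs => //; have fs_uniq := vplan_uniq pos_inj pos_arc pl.
rewrite big_uniq //= /total_length [leRHS](bigID (mem fs)) /=.
rewrite [X in (_ <= X + _)%R](eq_bigl (mem fs)); last first.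
  by move=> e /=; case e_in: (e \in fs); rewrite ?andbF // (sub _ e_in).
rewrite lerDl sumr_ge0 // => e /andP[eF _].
by case: validI => _ _ _ _ /(_ e (subsetP FE _ eF))[].
Qed.

Lemma denprod_gt0 : 0 < denprod w.
Proof. by rewrite denprodE; apply: prodn_gt0 => e; rewrite absz_gt0 denq_eq0. Qed.

Lemma optimal_plan_solves out : optimal_plan_output w num_of out -> solves I out.
Proof.
have D_gt0 : (0 < (denprod w)%:R :> rat)%R by rewrite ltr0n denprod_gt0.
have toplan W F : feasible I W F -> exists ks,
    [/\ plan w num_of (start w num_of) ks, forall k, k \in ks -> k < size es
      & (\sum_(e <- [seq arc k | k <- ks]) len e <= total_length I F)%R].
  move=> /feasible_vplan[fs pl le].
  (* Plans on the input word name arcs by their position in the list, recovered here with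
     [index]. *)
  have fsE : [seq arc k | k <- [seq index e es | e <- fs]] = fs.
    rewrite -map_comp -[RHS]map_id; apply/eq_in_map => e /(vplan_sub pl).
    by rewrite -mem_es => e_in; rewrite /= /arc nth_index.
  have ks_lt k : k \in [seq index e es | e <- fs] -> k < size es.
    by case/mapP => e /(vplan_sub pl); rewrite -mem_es -index_mem => ? ->.
  exists [seq index e es | e <- fs]; split=> //; last by rewrite fsE.
  by rewrite startE plan_vplan // fsE.
case=> [[-> none]|[ks -> [pl mini]]].
  right; split=> // -[W [F /toplan[ks [pl _ _]]]].
  by have := none ks; rewrite pl.
left; have ks_lt := plan_lt pl.
have pl' := pl; rewrite startE plan_vplan // in pl'.
have [feas tot] := vplan_feasible pl'.
do 2!eexists; split.
  split; first exact: feas.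
  move=> W' F' /toplan[ks' [pl2 ks'_lt le]]; rewrite tot; apply: le_trans le.
  by rewrite -(ler_pM2l D_gt0) -!costE // ler_nat mini.
exists [seq arc k | k <- ks].
  apply: uniq_perm; rewrite ?enum_uniq ?(vplan_uniq pos_inj pos_arc pl') //.
  by move=> e; rewrite mem_enum inE.
congr (1 :: flatten _); rewrite -map_comp; apply/eq_in_map => k /ks_lt k_lt.
by rewrite /arc_out enc_tail // enc_head.
Qed.

End Numbered.

Lemma steiner_prog_solves (G : nat) :
  (bitsize w * bitsize w) ^ size ts + bitsize w * (bitsize w * bitsize w)
    + (bitsize w + bitsize w) <= G ->
  exists t out,
    [/\ runs (compile steiner_prog) w t out, t <= ptime steiner_prog G & solves I out].
Proof.
set L := bitsize w => G_ge.
have szw : size w = 4 + (size ts + 5 * size es).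
  rewrite /w /= size_cat size_map; congr (4 + (_ + _)).
  by elim: (es) => //= e l ->; rewrite mulnS.
have w_le : size w <= L by exact: size_bitsize.
have nv_le : nvert I <= L by have := nvert_le; lia.
have ts_gt0 : 0 < size ts.
  by case: validI => _ + _ _ _; rewrite cardE -(perm_size perm_ts); exact: ltnW.
have es_gt0 : 0 < size es.
  have [e e_in] : exists e, e \in arcs I.
    case: validI => _ T2 rT conn _.
    have /card_gt0P[t t_in] : 0 < #|terminals I| by lia.
    have /connectP[[|z q]] := conn t; first by move=> _ /= tr; rewrite -tr t_in in rT.
    by move=> /= /andP[rz _] _; exists (r, z).
  by rewrite -mem_es in e_in; case: (es) e_in.
pose h v := #|ancestors (arcs I) (insubd r v)|.
have hE (v : 'I_(nvert I)) : h (val v) = #|ancestors (arcs I) v| by rewrite /h valKd.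
have L_gt0 : 0 < L by lia.
have LL_le : nvert I * nvert I <= L * L by exact: leq_mul.
have L3_ge : L <= L * (L * L) by rewrite leq_pmulr // muln_gt0 L_gt0.
have [||||||||||||||||t [out [ex t_le [pos numb H]]]] := @steiner_prog_correct w G L h.
- exact: nth_lt_bitsize.
- by apply: leq_ltn_trans w_le _; exact: ltn_expl.
- exact: L_gt0.
- exact: (ltn_ord r).
- by move=> k k_lt; rewrite enc_tail // enc_head // !ltn_ord.
- move=> k k_lt; rewrite enc_tail // enc_head // !hE; apply: ancestors_arc => //.
  by rewrite -surjective_pairing; exact: arc_in.
- by move=> v _; rewrite /h -[X in _ < X]card_ord; exact: ancestors_lt.
- by move=> k k_lt; rewrite enc_head //; apply: head_neq_root; exact: arc_in.
- by move=> j j_lt; rewrite enc_term // ltn_ord.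
- by move=> k k_lt; rewrite enc_den // absz_gt0 denq_eq0.
- rewrite denprodE; apply: leq_trans (prod_lt_bitsize _ es_gt0) _.
  by rewrite leq_exp2l // bitsize_den.
- exact: ts_gt0.
- change (size ts <= G); lia.
- change (size es <= G); lia.
- apply: leq_trans G_ge; rewrite -addnA addnCA; apply: leq_trans (leq_addr _ _).
  by change (nvert I * (nvert I * nvert I) <= L * (L * L)); apply: leq_mul.
- apply: leq_trans G_ge; rewrite leq_add2r; apply: leq_trans (leq_addr _ _).
  change ((nvert I * nvert I) ^ size ts <= (L * L) ^ size ts).
  by rewrite leq_exp2r.
by exists t, out; split=> //; exact: optimal_plan_solves H.
Qed.

End Encoded.
Theorem theorem6p3 (K : nat) (hK : 2 <= K) :
  solvable_in_polynomial_time
    (fun I : instance =>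
       [/\ valid I, acyclic (arcs I) & #|terminals I| = K])
    encodes solves.
Proof.
have [q qE] := ptime_poly steiner_prog.
(* The parameter [G] as a function of the input size; [K] occurs only as a constant exponent, so
   this is a polynomial. *)
pose g : {poly nat} := (('X * 'X) ^+ K + 'X * ('X * 'X) + ('X + 'X))%R.
exists (compile steiner_prog), (q \Po g)%R => I w [validI acyclicI cardT] [ts [es [pts pes wE]]].
have sz : size ts = K by rewrite (perm_size pts) -cardE.
have gE L : ((L * L) ^ K + L * (L * L) + (L + L))%N = g.[L]%R.
  by rewrite /g !hornerE.
have [|t [out [ex t_le sol]]] := @steiner_prog_solves I ts es validI acyclicI pts pes g.[bitsize w]%R.
  by rewrite -wE sz gE.
exists t, out; split=> //; first by rewrite wE.
by rewrite horner_comp -qE.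
Qed.
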